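(* The unit disk $\mathbb{D}=\{z\in\mathbb{C}:|z|<1\}$ is a SULD (with $\mathbb{C}$ identified with $\mathbb{R}^2$). Moreover, every analytic simply connected domain $\Omega\subsetneq\mathbb{C}$ is a SULD.
   Context: Analytic simply connected domain: an open connected, simply connected set $\Omega\subsetneq\mathbb{C}$ for which there is a univalent function $f$, analytic near $\partial\mathbb{D}$, such that $\partial\Omega=f(\partial\mathbb{D})$. Write $\mathbb{R}^n_+=\{(x_1,\dots,x_n):x_1>0\}$. Smooth domain: a connected open set $\Omega\subset\mathbb{R}^n$ such that for each $x\in\partial\Omega$ there are an open ball $B_x$ centred at $x$ and a smooth bijection $\Phi_x:B_x\to D\subset\mathbb{R}^n$ with smooth inverse, with $\Phi_x(B_x\cap\Omega)\subset\mathbb{R}^n_+$ and $\Phi_x(B_x\cap\partial\Omega)\subset\partial\mathbb{R}^n_+$; $\Phi_x$ is called the coordinate mapping associated with $B_x$. SULD (''Smooth Uniform Lipschitz Domain''): a set $\Omega\subset\mathbb{R}^n$ such that (1) $\Omega$ is a connected smooth domain; (2) $\overline\Omega$ has a countable open cover $\{U^0,U^1,\dots\}$ where $U^0\subseteq\Omega$ carries the Euclidean coordinates and each $U^k$, $k\ge1$, is one of the balls $B_x$, $x\in\partial\Omega$, with coordinate mapping $\Phi_k=(\Phi_k^1,\dots,\Phi_k^n)$; (3) on $U^k\cap\partial\Omega$, with $\gamma$ the inward unit normal, $\nabla\Phi_k^i\cdot\gamma=\delta_{1i}|\nabla\Phi_k^i|$ (i.e. $\Phi_k$ sends the normal to a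 vector in direction $(1,0,\dots,0)$); (4) there are constants $\mathscr{C},\mathscr{C}_1,\mathscr{C}_2,\mathscr{C}_3$ such that for all $k\ge1$, all $i,j$, and all $x,y\in U^k$: $|x-y|/\mathscr{C}\le|\Phi_k(x)-\Phi_k(y)|\le\mathscr{C}|x-y|$; $\max\{\|\partial\Phi_k^i/\partial x_j\|_\infty,\|\Delta\Phi_k^i\|_\infty\}\le\mathscr{C}_1$; $\max\{\mathrm{Lip}(\partial\Phi_k^i/\partial x_j),\mathrm{Lip}(\Delta\Phi_k^i)\}\le\mathscr{C}_2$ (Lipschitz constants); and, with $J_k$ the Jacobian of $\Phi_k$ and $A_k=J_kJ_k^T$, $\mathscr{C}_3^{-1}|v|^2\le v^TA_kv\le\mathscr{C}_3|v|^2$ for all $v\in\mathbb{R}^n$. *)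

(* Defs.v *)
From HB Require Import structures.
From mathcomp Require Import all_boot all_order all_algebra.
From mathcomp Require Import complex.
From mathcomp Require Import all_classical all_reals all_analysis.

Set Implicit Arguments.
Unset Strict Implicit.
Unset Printing Implicit Defensive.

Import Order.TTheory GRing.Theory Num.Theory.
Import numFieldNormedType.Exports.

Local Open Scope classical_set_scope.
Local Open Scope ring_scope.

(* R[i] with the topology given by its modulus. *)
HB.instance Definition _ (R : realType) :=
  NormedModule.copy R[i] (R[i] : numFieldType)^o.

Definition boundary (T : topologicalType) (A : set T) : set T :=
  closure A `\` interior A.

Section Topology.
Variables (R : realType) (T : topologicalType).
Implicit Types A : set T.

Definition path_connected A :=
  forall x y, A x -> A y ->
  exists g : R -> T, [/\ {within `[0, 1], continuous g},
    g @` `[0, 1] `<=` A, g 0 = x & g 1 = y].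

(* The homotopies fix the base point of the loop: H (_, 0) is the loop and
   H (_, 1) is constant. *)
Definition loops_contract A :=
  forall g : R -> T, {within `[0, 1], continuous g} ->
    g @` `[0, 1] `<=` A -> g 0 = g 1 ->
  exists H : R * R -> T,
    [/\ {within `[0, 1] `*` `[0, 1], continuous H},
        H @` (`[0, 1] `*` `[0, 1]) `<=` A,
        (forall t, 0 <= t <= 1 -> H (t, 0) = g t /\ H (t, 1) = g 0) &
        (forall s, 0 <= s <= 1 -> H (0, s) = g 0 /\ H (1, s) = g 0)].

Definition simply_connected A := path_connected A /\ loops_contract A.

End Topology.

(* The normed-module norm of 'rV[R]_n is the sup norm; the Euclidean norm is
   [enorm] (both induce the library's topology on 'rV[R]_n). *)
Section Euclidean.
Variables (R : realType) (n : nat).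
Implicit Types (u v x : 'rV[R]_n).

Definition edot u v : R := \sum_i u 0 i * v 0 i.

Definition enorm v : R := Num.sqrt (edot v v).

Definition eball x (r : R) : set 'rV[R]_n := [set y | enorm (y - x) < r].

End Euclidean.

Section Calculus.
Variables (R : realType) (n : nat).
Implicit Types (U : set 'rV[R]_n) (f : 'rV[R]_n -> R)
  (F : 'rV[R]_n -> 'rV[R]_n).

Definition partial (j : 'I_n) f : 'rV[R]_n -> R :=
  fun x => 'D_(delta_mx 0 j) f x.

Definition grad f (x : 'rV[R]_n) : 'rV[R]_n := \row_j partial j f x.

Definition laplacian f (x : 'rV[R]_n) : R := \sum_j partial j (partial j f) x.

Definition component F (i : 'I_n) : 'rV[R]_n -> R := fun x => F x 0 i.

(* Textbook convention: row i is the gradient of the i-th component (the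
   library's ['J F x] acts on row vectors and is the transpose of this). *)
Definition Jacobian F (x : 'rV[R]_n) : 'M[R]_n :=
  \matrix_(i, j) partial j (component F i) x.

(* Meaningful for open U. *)
Fixpoint Ck (k : nat) U f : Prop :=
  (forall x, U x -> {for x, continuous f}) /\
  if k is k'.+1 then
    forall j : 'I_n, (forall x, U x -> derivable f x (delta_mx 0 j)) /\
      Ck k' U (partial j f)
  else True.

Definition smooth_on U F := forall (i : 'I_n) (k : nat), Ck k U (component F i).

Definition supnorm_le U f (c : R) := forall x, U x -> `|f x| <= c.

Definition lip_le U f (c : R) :=
  forall x y, U x -> U y -> `|f x - f y| <= c * enorm (x - y).

End Calculus.

(* The ambient space is R^{n+1}, so that there is a first coordinate. *)
Section Domains.
Variables (R : realType) (n : nat).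
Local Notation E := 'rV[R]_n.+1.
Implicit Types (Omega : set E) (x g v : E).

Definition half_space : set E := [set x | 0 < x 0 0].

(* Phi is a smooth bijection with smooth inverse from the ball eball x r onto
   the open set D := Phi @` eball x r; Phi is irrelevant off the ball. *)
Definition coordinate_mapping Omega x (r : R) (Phi : E -> E) :=
  let B := eball x r in
  [/\ 0 < r, smooth_on B Phi, open (Phi @` B),
      exists2 Psi : E -> E, smooth_on (Phi @` B) Psi &
        forall y, B y -> Psi (Phi y) = y &
      Phi @` (B `&` Omega) `<=` half_space /\
      Phi @` (B `&` boundary Omega) `<=` boundary half_space].

(* The balls B_x := eball x (rad x) and coordinate mappings Phi x. *)
Definition smooth_atlas Omega (rad : E -> R) (Phi : E -> E -> E) :=
  forall x, boundary Omega x -> coordinate_mapping Omega x (rad x) (Phi x).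

Definition smooth_domain Omega :=
  [/\ open Omega, connected Omega &
      exists rad Phi, smooth_atlas Omega rad Phi].

Definition tangent_vector (M : set E) x v :=
  exists c : R -> E, [/\ c 0 = x, \forall t \near 0, M (c t) &
    is_derive (0 : R) (1 : R) c v].

Definition inward_unit_normal Omega x g :=
  [/\ enorm g = 1,
      (forall v, tangent_vector (boundary Omega) x v -> edot g v = 0) &
      \forall t \near 0^'+, Omega (x + t *: g)].

(* At a boundary point of a smooth domain the inward unit normal
   exists and is unique, so the existential quantifier just names it. *)
Definition maps_normal_to_e1 Omega (Phi : E -> E) x :=
  exists2 g, inward_unit_normal Omega x g &
    forall i : 'I_n.+1, let df := grad (component Phi i) x in
      edot df g = (i == 0)%:R * enorm df.

Definition uniform_bounds (C C1 C2 C3 : R) (U : set E)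
    (Phi : E -> E) :=
  [/\ (forall x y, U x -> U y ->
         enorm (x - y) / C <= enorm (Phi x - Phi y) <= C * enorm (x - y)),
      (forall i j : 'I_n.+1, supnorm_le U (partial j (component Phi i)) C1 /\
                             supnorm_le U (laplacian (component Phi i)) C1),
      (forall i j : 'I_n.+1, lip_le U (partial j (component Phi i)) C2 /\
                             lip_le U (laplacian (component Phi i)) C2) &
      (forall x, U x -> forall v,
         let J := Jacobian Phi x in let A := J *m J^T in
         C3^-1 * enorm v ^+ 2 <= (v *m A *m v^T) 0 0 <= C3 * enorm v ^+ 2)].

(* The cover of the closure is U 0, U 1, ...; for k >= 1 the set U k is the ball
   of the atlas centred at c k, with coordinate mapping Phi (c k). Repetitions
   are allowed, so finitely many balls may be used; c 0 is irrelevant. *)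
Definition SULD Omega :=
  smooth_domain Omega /\
  exists (rad : E -> R) (Phi : E -> E -> E),
    smooth_atlas Omega rad Phi /\
      exists (U : nat -> set E) (c : nat -> E),
        [/\ open (U 0%N) /\ U 0%N `<=` Omega,
            (forall k, (0 < k)%N ->
               boundary Omega (c k) /\ U k = eball (c k) (rad (c k))),
            closure Omega `<=` \bigcup_k U k,
            (forall k, (0 < k)%N -> forall x, U k x -> boundary Omega x ->
               maps_normal_to_e1 Omega (Phi (c k)) x) &
            exists C C1 C2 C3 : R, [/\ 0 < C, 0 < C1, 0 < C2 & 0 < C3] /\
              forall k, (0 < k)%N ->
                uniform_bounds C C1 C2 C3 (U k) (Phi (c k))].

End Domains.

Section ComplexPlane.
Variable R : realType.
Local Notation C := R[i].

Definition unit_disk : set C := [set z | `|z| < 1].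

Definition unit_circle : set C := [set z | `|z| = 1].

(* Local convergent power series expansions; [series] is the sequence of
   partial sums. *)
Definition analytic_at (f : C -> C) (w : C) :=
  exists (a : nat -> C) (r : C), 0 < r /\
    forall z : C, `|z - w| < r ->
      series (fun k => a k * (z - w) ^+ k) @ \oo --> f z.

Definition analytic_simply_connected_domain (Omega : set C) :=
  [/\ open Omega, connected Omega, simply_connected R Omega, Omega <> setT &
      exists (N : set C) (f : C -> C),
        [/\ open N, unit_circle `<=` N, (forall w, N w -> analytic_at f w),
            set_inj N f & boundary Omega = f @` unit_circle]].

Definition R2_of_complex (z : C) : 'rV[R]_2 :=
  \row_(i < 2) if i == 0 then complex.Re z else complex.Im z.

End ComplexPlane.

(* Main.v *)
Require Import Defs.
From mathcomp Require Import all_boot all_order all_algebra.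
From mathcomp Require Import complex.
From mathcomp Require Import all_classical all_reals all_analysis.
From mathcomp Require Import ring lra.

(** The boundary of [Omega] is the image of the unit circle under a function [f]
    that is injective and analytic near the circle. An injective analytic
    function has a nonzero derivative ([pser_inj_coef1]), so [f] has holomorphic
    local inverses. Composed with a Cayley transform, such an inverse maps a
    neighbourhood of a boundary point holomorphically onto a neighbourhood of 0
    and the boundary into the imaginary axis ([chart_of_side]). It is a
    coordinate mapping as soon as [Omega] lies, near the curve, on exactly one
    side of it.

    Conformality of these charts gives all the quantitative conditions. If [d]
    is the complex derivative of a chart, the Jacobian is [cabs d] times a
    rotation: it carries the normal to a multiple of the first basis vector,
    and the product with its transpose is the scalar matrix [cabs d ^+ 2]. The
    components are harmonic, so the Laplacians vanish. The Lipschitz bounds hold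
    on a small ball because the chart and its derivative are strictly
    differentiable at its centre ([chart_bounds]). The boundary is compact, so
    finitely many such balls suffice and the constants can be made uniform
    ([SULD_of_charts]).

    That [Omega] lies on one side of the curve is a topological fact
    ([side_exists]). The inner and the outer collar of the circle have
    connected images that avoid the boundary, so each of them is either in
    [Omega] or disjoint from it. They are not both disjoint from [Omega]. If
    both were in [Omega], then [Omega] would be the complement of the curve; a
    large circle would lie in [Omega] and would contract there, hence in the
    complement of a point of the curve. This is impossible, because a circle
    traversed once has no continuous closed square root, whereas the existence
    of such a root is invariant under homotopy in the complement of a point
    ([loops_not_contract]). A bounded set such as the disk is one-sided for the
    simpler reason that it misses points of arbitrarily large modulus.

    The analysis rests on strict differentiability over the complex numbers:
    convergent power series are strictly differentiable to all orders
    ([pser_hol]), and Newton's iteration inverts a strictly differentiable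
    function near a point where its derivative is not 0 ([local_inverse]). The
    real and imaginary parts of such functions have partial derivatives of all
    orders ([hol_Ck]). *)

Set Implicit Arguments.
Unset Strict Implicit.
Unset Printing Implicit Defensive.

Import Order.TTheory GRing.Theory Num.Theory.
Import numFieldNormedType.Exports.

Local Open Scope classical_set_scope.
Local Open Scope ring_scope.

(** * The modulus and the topology of the complex plane *)

Section Modulus.
Variable R : realType.
Local Notation C := R[i].
Implicit Types (z w a b : C) (x y e r : R).

(** The norm of [R[i]] takes its values in [R[i]]; this modulus is real, so
    that estimates take place in an ordered field. *)
Definition cabs z : R := Normc.normc z.

Lemma normE z : `|z| = (cabs z)%:C%C. Proof. by []. Qed.

Lemma cabs_sqr z : cabs z ^+ 2 = complex.Re z ^+ 2 + complex.Im z ^+ 2.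
Proof. by case: z => a b; rewrite /cabs /= sqr_sqrtr// addr_ge0// sqr_ge0. Qed.

Lemma cabs_ge0 z : 0 <= cabs z.
Proof. by case: z => a b; rewrite /cabs /= sqrtr_ge0. Qed.

Lemma cabsM z w : cabs (z * w) = cabs z * cabs w.
Proof. exact: Normc.normcM. Qed.

Lemma cabsV z : cabs z^-1 = (cabs z)^-1.
Proof. exact: Normc.normcV. Qed.

Lemma cabs0 : cabs 0 = 0. Proof. exact: Normc.normc0. Qed.

Lemma cabs1 : cabs 1 = 1. Proof. exact: Normc.normc1. Qed.

Lemma cabsX z n : cabs (z ^+ n) = cabs z ^+ n.
Proof.
by elim: n => [|n IH]; rewrite ?expr0 ?cabs1// !exprS cabsM IH.
Qed.

Lemma cabsN z : cabs (- z) = cabs z.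
Proof. exact: normcN. Qed.

Lemma cabsD z w : cabs (z + w) <= cabs z + cabs w.
Proof. exact: le_normcD. Qed.

Lemma cabsB z w : cabs (z - w) = cabs (w - z).
Proof. by rewrite -cabsN opprB. Qed.

Lemma cabs_tri a z w : cabs (z - w) <= cabs (z - a) + cabs (a - w).
Proof. by rewrite -(subrKA a); exact: cabsD. Qed.

Lemma cabsBD z w : cabs z - cabs w <= cabs (z - w).
Proof. by rewrite lerBlDr -{1}(subrK w z) cabsD. Qed.

Lemma cabs_dist z w : `|cabs z - cabs w| <= cabs (z - w).
Proof. by rewrite ler_norml cabsBD andbT lerNl opprB cabsB cabsBD. Qed.

Lemma cabs_eq0 z : (cabs z == 0) = (z == 0).
Proof.
by apply/eqP/eqP => [/Normc.eq0_normc//|->]; rewrite cabs0.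
Qed.

Lemma cabs_gt0 z : (0 < cabs z) = (z != 0).
Proof. by rewrite lt_neqAle cabs_ge0 andbT eq_sym cabs_eq0. Qed.

Lemma cabs_real x : cabs x%:C%C = `|x|.
Proof. by rewrite /cabs /= expr0n /= addr0 sqrtr_sqr. Qed.

Lemma cabs_nat n : cabs n%:R = n%:R.
Proof.
by rewrite -(rmorph_nat (real_complex R)) cabs_real ger0_norm.
Qed.

Lemma le_Re_cabs z : `|complex.Re z| <= cabs z.
Proof.
rewrite -(@ler_pXn2r _ 2)// ?nnegrE ?cabs_ge0// cabs_sqr real_normK ?num_real//.
by rewrite lerDl sqr_ge0.
Qed.

Lemma le_Im_cabs z : `|complex.Im z| <= cabs z.
Proof.
rewrite -(@ler_pXn2r _ 2)// ?nnegrE ?cabs_ge0// cabs_sqr real_normK ?num_real//.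
by rewrite lerDr sqr_ge0.
Qed.

Lemma cabs_le z : cabs z <= `|complex.Re z| + `|complex.Im z|.
Proof.
rewrite -(@ler_pXn2r _ 2)// ?nnegrE ?cabs_ge0 ?addr_ge0// cabs_sqr.
rewrite -(real_normK (num_real (complex.Re z))).
rewrite -(real_normK (num_real (complex.Im z))) sqrrD addrAC lerDl.
by rewrite mulrn_wge0// mulr_ge0.
Qed.

Lemma ReD z w : complex.Re (z + w) = complex.Re z + complex.Re w.
Proof. by case: z w => ? ? [? ?]. Qed.
Lemma ReN z : complex.Re (- z) = - complex.Re z.
Proof. by case: z. Qed.
Lemma ReB z w : complex.Re (z - w) = complex.Re z - complex.Re w.
Proof. by rewrite ReD ReN. Qed.
Lemma ReM z w : complex.Re (z * w) =
  complex.Re z * complex.Re w - complex.Im z * complex.Im w.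
Proof. by case: z w => ? ? [? ?]. Qed.
Lemma ImD z w : complex.Im (z + w) = complex.Im z + complex.Im w.
Proof. by case: z w => ? ? [? ?]. Qed.
Lemma ImN z : complex.Im (- z) = - complex.Im z.
Proof. by case: z. Qed.
Lemma ImB z w : complex.Im (z - w) = complex.Im z - complex.Im w.
Proof. by rewrite ImD ImN. Qed.
Lemma ImM z w : complex.Im (z * w) =
  complex.Re z * complex.Im w + complex.Im z * complex.Re w.
Proof. by case: z w => ? ? [? ?]. Qed.

Lemma complex_eq z w :
  complex.Re z = complex.Re w -> complex.Im z = complex.Im w -> z = w.
Proof. by case: z w => ? ? [? ?] /= -> ->. Qed.

Lemma conjc_mul_cabs z : z * z^*%C = (cabs z ^+ 2)%:C%C.
Proof. by apply: complex_eq; rewrite ?ReM ?ImM ?cabs_sqr /=; case: z => a b /=; ring. Qed.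

Lemma ReZ (t : R) z : complex.Re (t%:C%C * z) = t * complex.Re z.
Proof. by rewrite ReM /= mul0r subr0. Qed.

Lemma cabs_conj z : cabs (z^*)%C = cabs z.
Proof. by case: z => a b; rewrite /cabs /= sqrrN. Qed.

Lemma cabs_lt_norm z e : (cabs z < e) = (`|z| < e%:C%C).
Proof. by rewrite normE ltcR. Qed.

Lemma gt0_complex (t : C) : 0 < t -> exists2 e : R, 0 < e & t = e%:C%C.
Proof.
case: t => a b; rewrite ltcE /= => /andP[/eqP -> a0].
by exists a.
Qed.

(** A positive element of [R[i]] is a positive real, so balls with a real
    radius suffice. *)
Lemma nbhsC z (P : set C) :
  nbhs z P <-> exists2 e : R, 0 < e & forall w, cabs (w - z) < e -> P w.
Proof.
split.
  move=> /nbhs_ballP[t /= /gt0_complex[e e0 ->] h]; exists e => // w we.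
  by apply: h; rewrite -ball_normE /ball_ /= -cabs_lt_norm cabsB.
move=> [e e0 h]; apply/nbhs_ballP; exists e%:C%C => /=; first by rewrite ltcR.
by move=> w; rewrite -ball_normE /ball_ /= -cabs_lt_norm cabsB => /h.
Qed.

Lemma nearC z (P : C -> Prop) :
  (\forall w \near z, P w) <->
  exists2 e : R, 0 < e & forall w, cabs (w - z) < e -> P w.
Proof. exact: nbhsC. Qed.

Lemma open_cball p r : open [set z : C | cabs (z - p) < r].
Proof.
rewrite openE => z /= zr; apply/nbhsC; exists (r - cabs (z - p)); first by rewrite subr_gt0.
by move=> w wz; apply: le_lt_trans (cabs_tri z _ _) _; rewrite -ltrBrDr.
Qed.

Lemma open_cball0 r : open [set z : C | cabs z < r].
Proof.
have := @open_cball 0 r; congr open; apply/funext => z.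
by rewrite /mkset subr0.
Qed.

Lemma cabs_sign (sigma : R) : sigma ^+ 2 = 1 -> cabs sigma%:C%C = 1.
Proof.
move=> s1; rewrite cabs_real; apply/eqP.
by rewrite -(@eqrXn2 _ 2)// real_normK ?num_real// s1 expr1n.
Qed.

End Modulus.

(** * Strict complex derivatives *)

Section StrictDerivative.
Variable R : realType.
Local Notation C := R[i].
Implicit Types (z w a b c d : C) (e r : R) (f g : C -> C) (U V : set C).

Definition near2 z (P : C -> C -> Prop) := exists2 r, 0 < r &
  forall a b, cabs (a - z) < r -> cabs (b - z) < r -> P a b.

Lemma near2I z (P Q : C -> C -> Prop) : near2 z P -> near2 z Q ->
  near2 z (fun a b => P a b /\ Q a b).
Proof.
move=> [r r0 hP] [s s0 hQ]; exists (Num.min r s); first by rewrite lt_min r0.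
move=> a b; rewrite !lt_min => /andP[? ?] /andP[? ?].
by split; [exact: hP|exact: hQ].
Qed.

Lemma near2S z (P Q : C -> C -> Prop) : (forall a b, P a b -> Q a b) ->
  near2 z P -> near2 z Q.
Proof. by move=> PQ [r r0 hP]; exists r => // a b ar br; apply/PQ/hP. Qed.

Lemma near2_near z (P : C -> Prop) : (\forall w \near z, P w) ->
  near2 z (fun a b => P a /\ P b).
Proof. by move=> /nearC[r r0 h]; exists r => // a b /h ? /h ?. Qed.

(** The derivative is strict: the error is controlled for two free points near
    [z], not only for differences with the value at [z]. A single such
    estimate contains local Lipschitz bounds, local injectivity when [d] is
    nonzero, and the contraction behind the inverse function theorem. *)
Definition sderiv f z d := forall e, 0 < e ->
  near2 z (fun a b => cabs (f a - f b - d * (a - b)) <= e * cabs (a - b)).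

(** The source is an arbitrary space, so that the same rules serve for
    functions of a complex variable, for paths and for homotopies. *)
Definition ccont (T : topologicalType) (f : T -> C) (z : T) :=
  forall e, 0 < e -> \forall w \near z, cabs (f w - f z) < e.

Lemma sderiv_lip f z d : sderiv f z d ->
  near2 z (fun a b => cabs (f a - f b) <= (cabs d + 1) * cabs (a - b)).
Proof.
move=> /(_ 1 ltr01); apply: near2S => a b h.
rewrite mulrDl -cabsM -lerBlDl; apply: le_trans h; exact: cabsBD.
Qed.

Lemma sderiv_low f z d : sderiv f z d -> d != 0 ->
  near2 z (fun a b => cabs d / 2 * cabs (a - b) <= cabs (f a - f b)).
Proof.
move=> fd d0; have d2 : 0 < cabs d / 2 by rewrite divr_gt0 ?cabs_gt0.
apply: near2S (fd _ d2) => a b h.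
have := cabsBD (d * (a - b)) (f a - f b).
rewrite (cabsB (d * _)) cabsM => h1; lra.
Qed.

Lemma sderiv_cont f z d : sderiv f z d -> ccont f z.
Proof.
move=> /sderiv_lip[r r0 h] e e0; apply/nearC.
have K0 : 0 < cabs d + 1 by rewrite ltr_wpDl ?cabs_ge0.
exists (Num.min r (e / (cabs d + 1))); first by rewrite lt_min r0 divr_gt0.
move=> w; rewrite lt_min => /andP[wr we].
apply: le_lt_trans (h _ _ wr _) _; first by rewrite subrr cabs0.
by rewrite mulrC -ltr_pdivlMr.
Qed.

Lemma sderiv_ext f g z d : (\forall w \near z, f w = g w) ->
  sderiv f z d -> sderiv g z d.
Proof.
move=> fg fd e e0; apply: near2S (near2I (near2_near fg) (fd e e0)).
by move=> a b [[-> ->]].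
Qed.

Lemma ccont_ext f g z : (\forall w \near z, f w = g w) -> ccont f z -> ccont g z.
Proof.
move=> fg fd e e0; have fgz := nbhs_singleton fg.
near=> w; rewrite -fgz -(near fg w)//; near: w; exact: fd.
Unshelve. all: by end_near. Qed.

Lemma sderiv_cst c z : sderiv (fun=> c) z 0.
Proof.
by move=> e e0; exists 1 => // a b _ _; rewrite subrr mul0r subr0 cabs0 mulr_ge0
  ?cabs_ge0 ?ltW.
Qed.

Lemma sderiv_id z : sderiv id z 1.
Proof.
by move=> e e0; exists 1 => // a b _ _; rewrite mul1r subrr cabs0 mulr_ge0
  ?cabs_ge0 ?ltW.
Qed.

Lemma sderiv_unique f z d1 d2 : sderiv f z d1 -> sderiv f z d2 -> d1 = d2.
Proof.
move=> h1 h2; apply/eqP; rewrite -subr_eq0 -cabs_eq0 eq_le cabs_ge0 andbT.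
apply/ler_addgt0Pr => e e0; rewrite add0r; have e2 : 0 < e / 2 by rewrite divr_gt0.
have [r r0 hr] := near2I (h1 _ e2) (h2 _ e2).
have rE : cabs (r / 2)%:C%C = r / 2 by rewrite cabs_real gtr0_norm// divr_gt0.
have := hr (z + (r / 2)%:C%C) z; rewrite addrAC subrr add0r cabs0 rE.
move=> [|//|H1 H2]; first by rewrite ltr_pdivrMr// ltr_pMr// ltr1n.
set t := (r / 2)%:C%C in H1 H2; set D := f _ - f _ in H1 H2.
have E : (d1 - d2) * t = (D - d2 * t) - (D - d1 * t) by ring.
have := cabsD (D - d2 * t) (- (D - d1 * t)); rewrite -E cabsN cabsM rE => H3.
have r2 : 0 < r / 2 by rewrite divr_gt0.
rewrite -(ler_pM2r r2); lra.
Qed.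

Lemma sderivD f g z d1 d2 : sderiv f z d1 -> sderiv g z d2 ->
  sderiv (fun w => f w + g w) z (d1 + d2).
Proof.
move=> fd gd e e0; have e2 : 0 < e / 2 by rewrite divr_gt0.
apply: near2S (near2I (fd _ e2) (gd _ e2)) => a b [hf hg].
have -> : f a + g a - (f b + g b) - (d1 + d2) * (a - b) =
  (f a - f b - d1 * (a - b)) + (g a - g b - d2 * (a - b)) by ring.
by apply: le_trans (cabsD _ _) _; lra.
Qed.

(** With [M] above all the quantities involved, each of the four error terms
    below is at most [e / 4] times the distance of the two points. *)
Lemma sderivM f g z d1 d2 : sderiv f z d1 -> sderiv g z d2 ->
  sderiv (fun w => f w * g w) z (d1 * g z + f z * d2).
Proof.
move=> fd gd e e0.
pose M := 1 + cabs (f z) + cabs (g z) + cabs d1 + cabs d2.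
have [Hf Hg Hd1 Hd2] := And4 (cabs_ge0 (f z)) (cabs_ge0 (g z)) (cabs_ge0 d1)
  (cabs_ge0 d2).
have M0 : 0 < M by rewrite /M; lra.
have e1 : 0 < e / (4 * M) by rewrite divr_gt0 ?mulr_gt0.
apply: near2S (near2I (near2I (fd _ e1) (gd _ e1)) (near2I
  (near2I (near2_near (sderiv_cont fd ltr01)) (near2_near (sderiv_cont gd ltr01)))
  (near2I (near2_near (sderiv_cont fd e1)) (near2_near (sderiv_cont gd e1))))).
move=> a b [[hf hg]] [[[hfa1 _]] [_ hgb1]] [[hfa _] [_ hgb]].
have -> : f a * g a - f b * g b - (d1 * g z + f z * d2) * (a - b) =
  f a * (g a - g b - d2 * (a - b)) + g b * (f a - f b - d1 * (a - b)) +
  ((f a - f z) * (d2 * (a - b)) + (g b - g z) * (d1 * (a - b))) by ring.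
set E := e / (4 * M) in e1 hf hg hfa hgb *.
have -> : e = E * M * 4 by rewrite /E; field; apply: lt0r_neq0.
have fa : cabs (f a) <= M.
  by have := cabsBD (f a) (f z); rewrite /M; lra.
have gb : cabs (g b) <= M.
  by have := cabsBD (g b) (g z); rewrite /M; lra.
have h1 : cabs (f a * (g a - g b - d2 * (a - b))) <= E * M * cabs (a - b).
  by rewrite cabsM (mulrC E) -mulrA ler_pM ?cabs_ge0.
have h2 : cabs (g b * (f a - f b - d1 * (a - b))) <= E * M * cabs (a - b).
  by rewrite cabsM (mulrC E) -mulrA ler_pM ?cabs_ge0.
have h3 : cabs ((f a - f z) * (d2 * (a - b))) <= E * M * cabs (a - b).
  by rewrite !cabsM mulrA ler_wpM2r ?cabs_ge0// ler_pM ?cabs_ge0 ?ltW// /M; lra.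
have h4 : cabs ((g b - g z) * (d1 * (a - b))) <= E * M * cabs (a - b).
  by rewrite !cabsM mulrA ler_wpM2r ?cabs_ge0// ler_pM ?cabs_ge0 ?ltW// /M; lra.
apply: le_trans (cabsD _ _) _; apply: le_trans (lerD (cabsD _ _) (cabsD _ _)) _.
lra.
Qed.

Lemma sderiv_comp f g z d1 d2 : sderiv f (g z) d1 -> sderiv g z d2 ->
  sderiv (fun w => f (g w)) z (d1 * d2).
Proof.
move=> fd gd e e0.
have K0 : 0 < cabs d2 + 1 by rewrite ltr_wpDl ?cabs_ge0.
have L0 : 0 < cabs d1 + 1 by rewrite ltr_wpDl ?cabs_ge0.
have e1 : 0 < e / 2 / (cabs d2 + 1) by rewrite !divr_gt0.
have e2 : 0 < e / 2 / (cabs d1 + 1) by rewrite !divr_gt0.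
have [r r0 hf] := fd _ e1.
apply: near2S (near2I (near2I (near2_near (sderiv_cont gd r0)) (sderiv_lip gd))
  (gd _ e2)) => a b [[[ha hb] hl] hg].
have -> : f (g a) - f (g b) - d1 * d2 * (a - b) =
  (f (g a) - f (g b) - d1 * (g a - g b)) + d1 * (g a - g b - d2 * (a - b))
  by ring.
apply: le_trans (cabsD _ _) _.
have h1 : e / 2 / (cabs d2 + 1) * cabs (g a - g b) <= e / 2 * cabs (a - b).
  apply: le_trans (ler_wpM2l (ltW e1) hl) _.
  by rewrite mulrA divfK// lt0r_neq0.
have h2 : cabs (d1 * (g a - g b - d2 * (a - b))) <= e / 2 * cabs (a - b).
  rewrite cabsM; have d1le : cabs d1 <= cabs d1 + 1 by rewrite lerDl.
  apply: le_trans (ler_pM (cabs_ge0 _) (cabs_ge0 _) d1le hg) _.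
  by rewrite mulrA [_ * (e / 2 / _)]mulrC divfK// lt0r_neq0.
have := hf _ _ ha hb; lra.
Qed.

Lemma sderivV z : z != 0 -> sderiv (fun w => w^-1) z (- (z^-1 * z^-1)).
Proof.
move=> z0 e e0; have nz : 0 < cabs z by rewrite cabs_gt0.
set n := cabs z in nz *.
exists (Num.min (n / 2) (e * n ^+ 3 / 12)).
  by rewrite lt_min !divr_gt0// mulr_gt0// exprn_gt0.
move=> a b; rewrite !lt_min => /andP[a1 a2] /andP[b1 b2].
have la : n / 2 <= cabs a by have := cabsBD z a; rewrite cabsB -/n; lra.
have lb : n / 2 <= cabs b by have := cabsBD z b; rewrite cabsB -/n; lra.
have ua : cabs a <= 2 * n by have := cabsBD a z; rewrite -/n; lra.
have a0 : a != 0 by rewrite -cabs_gt0; apply: lt_le_trans la; rewrite divr_gt0.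
have b0 : b != 0 by rewrite -cabs_gt0; apply: lt_le_trans lb; rewrite divr_gt0.
have -> : a^-1 - b^-1 - - (z^-1 * z^-1) * (a - b) =
  (a * (b - z) + z * (a - z)) / (z * z * (a * b)) * (a - b).
  by field; rewrite a0 b0 z0.
rewrite cabsM ler_wpM2r ?cabs_ge0// cabsM cabsV ler_pdivrMr; last first.
  by rewrite cabs_gt0 !mulf_neq0.
apply: le_trans (cabsD _ _) _; rewrite !cabsM -/n.
have h1 : cabs a * cabs (b - z) <= 2 * n * (e * n ^+ 3 / 12).
  exact: ler_pM (cabs_ge0 _) (cabs_ge0 _) ua (ltW b2).
have h2 : n * cabs (a - z) <= n * (e * n ^+ 3 / 12).
  exact: ler_wpM2l (ltW nz) _ _ (ltW a2).
have h3 : e * (n * n * ((n / 2) * (n / 2))) <= e * (n * n * (cabs a * cabs b)).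
  apply: (ler_wpM2l (ltW e0)); apply: ler_wpM2l; first by rewrite mulr_ge0 ?ltW.
  by apply: ler_pM => //; rewrite divr_ge0 ?ltW.
apply: le_trans h3; apply: le_trans (lerD h1 h2) _.
by rewrite le_eqVlt; apply/orP; left; apply/eqP; field.
Qed.

Lemma ccontD (T : topologicalType) (f g : T -> C) (z : T) :
  ccont f z -> ccont g z -> ccont (fun w : T => f w + g w) z.
Proof.
move=> fc gc e e0; have e2 : 0 < e / 2 by rewrite divr_gt0.
apply: filterS2 (fc _ e2) (gc _ e2) => w hf hg.
rewrite opprD addrACA; apply: le_lt_trans (cabsD _ _) _; lra.
Qed.

Lemma ccontM (T : topologicalType) (f g : T -> C) (z : T) :
  ccont f z -> ccont g z -> ccont (fun w : T => f w * g w) z.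
Proof.
move=> fc gc e e0; pose M := 1 + cabs (f z) + cabs (g z).
have [Hf Hg] := (cabs_ge0 (f z), cabs_ge0 (g z)).
have M0 : 0 < M by rewrite /M; lra.
have e1 : 0 < e / (2 * M) by rewrite divr_gt0 ?mulr_gt0.
apply: filterS3 (fc _ ltr01) (fc _ e1) (gc _ e1) => w hf1 hf hg.
have -> : f w * g w - f z * g z = f w * (g w - g z) + (f w - f z) * g z by ring.
have := cabsBD (f w) (f z) => hfw.
set E := e / (2 * M) in e1 hf hg *.
have -> : e = M * E + E * M by rewrite /E; field; apply: lt0r_neq0.
apply: le_lt_trans (cabsD _ _) _; rewrite !cabsM; apply: ltr_leD.
  have fM : cabs (f w) <= M by rewrite /M; lra.
  by apply: le_lt_trans (ler_wpM2r (cabs_ge0 _) fM) _; rewrite ltr_pM2l.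
by apply: ler_pM; rewrite ?cabs_ge0// ?ltW// /M; lra.
Qed.

Lemma ccont_comp (T : topologicalType) f (g : T -> C) (z : T) :
  ccont f (g z) -> ccont g z -> ccont (fun w : T => f (g w)) z.
Proof.
by move=> fc gc e /fc/nearC[r /gc gr h]; apply: filterS gr => w /h.
Qed.

Lemma ccontV (T : topologicalType) (f : T -> C) (x : T) : ccont f x -> f x != 0 ->
  ccont (fun y => (f y)^-1) x.
Proof.
move=> fc f0; apply: (@ccont_comp _ (fun z => z^-1) f) => //.
exact: sderiv_cont (sderivV f0).
Qed.

Lemma ccont_cabs (T : topologicalType) (f : T -> C) (x : T) : ccont f x ->
  ccont (fun y => (cabs (f y))%:C%C) x.
Proof.
move=> fc e e0; apply: filterS (fc e e0) => y; apply: le_lt_trans.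
by rewrite -rmorphB cabs_real cabs_dist.
Qed.

(** The derivative is quantified inside the recursion, which makes the closure
    properties inductions on [k]. On an open set it does not depend on the
    choice, by [sderiv_unique]. *)
Fixpoint hol (k : nat) U f : Prop :=
  if k is k'.+1 then
    exists2 g, (forall z, U z -> sderiv f z (g z)) & hol k' U g
  else forall z, U z -> ccont f z.

Lemma hol_cont k U f z : hol k U f -> U z -> ccont f z.
Proof.
by case: k => [|k] /=; [exact|move=> [g fg _] /fg; exact: sderiv_cont].
Qed.

Lemma hol_pred k U f : hol k.+1 U f -> hol k U f.
Proof.
elim: k f => [|k IH] f; first by move=> h z /(hol_cont h).
by move=> [g fg hg]; exists g => //; exact: IH.
Qed.

Lemma hol_ext k U f g : open U -> (forall z, U z -> f z = g z) ->
  hol k U f -> hol k U g.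
Proof.
move=> oU fg; have nfg z : U z -> \forall w \near z, f w = g w.
  by move=> Uz; apply: filterS fg (open_nbhs_nbhs _); split.
case: k => [|k] /=; first by move=> h z Uz; exact: ccont_ext (nfg _ Uz) (h _ Uz).
move=> [f' h hf']; exists f' => // z Uz; exact: sderiv_ext (nfg _ Uz) (h _ Uz).
Qed.

Lemma hol_sub k U V f : U `<=` V -> hol k V f -> hol k U f.
Proof.
move=> UV; elim: k f => [|k IH] f /=; first by move=> h z /UV/h.
by move=> [g fg hg]; exists g; [move=> z /UV/fg|exact: IH].
Qed.

Lemma hol_cst k U c : hol k U (fun=> c).
Proof.
elim: k c => [|k IH] c /=; last by exists (fun=> 0) => // z _; exact: sderiv_cst.
by move=> z _; exact: sderiv_cont (sderiv_cst c z).
Qed.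

Lemma hol_id k U : hol k U id.
Proof.
case: k => [|k] /=; first by move=> z _; exact: sderiv_cont (sderiv_id z).
by exists (fun=> 1); [move=> z _; exact: sderiv_id|exact: hol_cst].
Qed.

Lemma holD k U f g : hol k U f -> hol k U g -> hol k U (fun z => f z + g z).
Proof.
elim: k f g => [|k IH] f g /=.
  by move=> hf hg z Uz; apply: ccontD; [exact: hf|exact: hg].
move=> [f' ff' hf'] [g' gg' hg']; exists (fun z => f' z + g' z); last exact: IH.
by move=> z Uz; apply: sderivD; [exact: ff'|exact: gg'].
Qed.

Lemma holM k U f g : hol k U f -> hol k U g -> hol k U (fun z => f z * g z).
Proof.
elim: k f g => [|k IH] f g.
  by move=> hf hg z Uz; apply: ccontM; [exact: hf|exact: hg].
move=> hf hg; have [hf1 hg1] := (hol_pred hf, hol_pred hg).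
move: hf hg => [f' ff' hf'] [g' gg' hg'].
exists (fun z => f' z * g z + f z * g' z); last by apply: holD; exact: IH.
by move=> z Uz; apply: sderivM; [exact: ff'|exact: gg'].
Qed.

Lemma hol_comp k U V f g : hol k V f -> hol k U g ->
  (forall z, U z -> V (g z)) -> hol k U (fun z => f (g z)).
Proof.
move=> + + UV; elim: k f g UV => [|k IH] f g UV.
  by move=> hf hg z Uz; apply: ccont_comp; [exact/hf/UV|exact: hg].
move=> hf hg; have hg1 := hol_pred hg; move: hf hg => [f' ff' hf'] [g' gg' hg'].
exists (fun z => f' (g z) * g' z); last by apply: holM => //; exact: IH.
by move=> z Uz; apply: sderiv_comp; [exact/ff'/UV|exact: gg'].
Qed.

Lemma hol_inv k : hol k [set z : C | z != 0] (fun z => z^-1).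
Proof.
elim: k => [|k IH]; first by move=> z /sderivV/sderiv_cont.
exists (fun z => -1 * (z^-1 * z^-1)) => [z /sderivV|]; first by rewrite mulN1r.
by apply: holM; [exact: hol_cst|exact: holM].
Qed.

(** The derivative of [phi] is the reciprocal of [F'] composed with [phi]
    itself, so each order of differentiability of [phi] yields the next
    one. *)
Lemma hol_inverse k U V (F' phi : C -> C) :
  (forall z, U z -> V (phi z)) ->
  (forall z, U z -> sderiv phi z (F' (phi z))^-1) ->
  (forall w, V w -> F' w != 0) -> (forall k, hol k V F') -> hol k U phi.
Proof.
move=> UV phid F0 hF'; elim: k => [|k IH]; first by move=> z /phid/sderiv_cont.
exists (fun z => (F' (phi z))^-1) => //.
apply: (@hol_comp k U [set z : C | z != 0] (fun z => z^-1) (fun z => F' (phi z))).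
- exact: hol_inv.
- exact: hol_comp (hF' k) IH UV.
- by move=> z /UV/F0.
Qed.

(** The derivatives that witness the various orders all agree, so the one
    found at order 1 serves at every order. *)
Lemma hol_derivative U f : open U -> (forall k, hol k U f) ->
  exists f', (forall z, U z -> sderiv f z (f' z)) /\ forall k, hol k U f'.
Proof.
move=> oU hf; have [f' ff' _] := hf 1%N; exists f'; split=> // k.
have [g fg hg] := hf k.+1; apply: hol_ext hg => // z Uz.
exact: sderiv_unique (fg _ Uz) (ff' _ Uz).
Qed.

End StrictDerivative.

(** * Completeness and local inverses *)

Section LocalInverse.
Variable R : realType.
Local Notation C := R[i].
Implicit Types (z w a b c d l : C) (e r K q : R) (u : nat -> C) (F : C -> C).

Definition ctends u l := forall e, 0 < e -> \forall n \near \oo, cabs (u n - l) < e.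

Lemma ctendsP u l : u @ \oo --> l <-> ctends u l.
Proof.
split=> [ul e e0|ul P /nbhsC[e e0 eP]].
  by apply: (ul [set w | cabs (w - l) < e]); apply/nbhsC; exists e.
by apply: filterS (ul e e0) => n /eP.
Qed.

Lemma geometric_cvg (x : nat -> R) K q : 0 <= q < 1 ->
  (forall n, `|x n.+1 - x n| <= K * q ^+ n) -> exists l : R, x @ \oo --> l.
Proof.
move=> /andP[q0 q1] h.
have K0 : 0 <= K by have := h 0%N; rewrite expr0 mulr1; apply: le_trans.
have cs : cvgn (series (telescope x)).
  apply: normed_cvg; apply: (@series_le_cvg _ _ (geometric K q)) => //.
  - by move=> n; exact: normr_ge0.
  - by move=> n; apply: mulr_ge0 => //; exact: exprn_ge0.
  - by apply: is_cvg_geometric_series; rewrite ger0_norm.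
exists (x 0%N + limn (series (telescope x))).
have xE : x = (fun n => x 0%N + series (telescope x) n).
  by apply/funext => n; rewrite -eq_sum_telescope.
rewrite {1}xE.
exact: (cvgD (cvg_cst (x 0%N)) cs).
Qed.

(** Completeness of the plane, in the form suited both to Newton's iteration
    and to power series. *)
Lemma geometric_ctends u K q : 0 <= q < 1 ->
  (forall n, cabs (u n.+1 - u n) <= K * q ^+ n) -> exists l, ctends u l.
Proof.
move=> q01 h.
have [x hx] : exists x : R, (fun n => complex.Re (u n)) @ \oo --> x.
  apply: (@geometric_cvg _ K q q01) => n /=.
  by rewrite -ReB; apply: le_trans (le_Re_cabs _) (h n).
have [y hy] : exists y : R, (fun n => complex.Im (u n)) @ \oo --> y.
  apply: (@geometric_cvg _ K q q01) => n /=.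
  by rewrite -ImB; apply: le_trans (le_Im_cabs _) (h n).
exists (x +i* y)%C => e e0; have e2 : 0 < e / 2 by rewrite divr_gt0.
move/cvgrPdist_lt : hx => /(_ _ e2) hx; move/cvgrPdist_lt : hy => /(_ _ e2) hy.
apply: filterS2 hx hy => n /= hx hy.
apply: le_lt_trans (cabs_le _) _; rewrite ReB ImB /= distrC -[X in _ + X]normrN.
by rewrite opprB (splitr e) ltrD// distrC.
Qed.

Lemma ctends_le u l c e : ctends u l -> (\forall n \near \oo, cabs (u n - c) <= e) ->
  cabs (l - c) <= e.
Proof.
move=> ul uc; apply/ler_addgt0Pr => d d0.
have [n [/= h1 h2]] := filter_ex (filterI (ul _ d0) uc).
by apply: le_trans (cabs_tri (u n) _ _) _; rewrite addrC lerD// cabsB ltW.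
Qed.

Lemma ctends_unique u l l' : ctends u l -> ctends u l' -> l = l'.
Proof.
move=> ul ul'; apply/eqP; rewrite -subr_eq0 -cabs_eq0 eq_le cabs_ge0 andbT.
apply/ler_addgt0Pr => d d0; rewrite add0r; apply: (ctends_le ul).
by apply: filterS (ul' _ d0) => n /ltW.
Qed.

(** Newton's iteration with the fixed slope [d]: the map [w - (F w - z) / d]
    contracts distances by 1/2 near [z0], so its iterates from [z0] move by at
    most [k / 2 ^ n] at step [n], where [k] is the first displacement, and
    they stay within [2 * k] of [z0]. *)
Lemma newton F z0 d r z : d != 0 -> 0 < r ->
  (forall a b, cabs (a - z0) < r -> cabs (b - z0) < r ->
     cabs (F a - F b - d * (a - b)) <= cabs d / 2 * cabs (a - b)) ->
  2 * cabs (z - F z0) < cabs d * r ->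
  exists2 w, cabs d * cabs (w - z0) <= 2 * cabs (z - F z0) & F w = z.
Proof.
move=> d0 r0 hF hz; have dp : 0 < cabs d by rewrite cabs_gt0.
pose T w := w - (F w - z) / d; pose u n := iter n T z0.
set k := cabs (z - F z0) / cabs d.
have kE : cabs (z - F z0) = k * cabs d by rewrite /k divfK ?lt0r_neq0.
have kr : 2 * k < r by rewrite -(ltr_pM2r dp); move: hz; rewrite kE; lra.
have k0 : 0 <= k by rewrite divr_ge0 ?cabs_ge0.
have main n : cabs (u n.+1 - u n) <= k * (2^-1) ^+ n /\
    cabs (u n - z0) <= 2 * k * (1 - (2^-1) ^+ n).
  elim: n => [|n [IH1 IH2]].
    split; last by rewrite subrr cabs0 expr0 subrr mulr0.
    rewrite expr0 mulr1 /u /= /T addrAC subrr sub0r -mulNr opprB cabsM cabsV.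
    exact: lexx.
  have t0 : 0 < (2^-1 : R) ^+ n by rewrite exprn_gt0// invr_gt0.
  have IH3 : cabs (u n.+1 - z0) <= 2 * k * (1 - 2^-1 ^+ n.+1).
    apply: le_trans (cabs_tri (u n) _ _) _; rewrite exprS.
    by move: (lerD IH1 IH2); congr (_ <= _); field.
  split=> //.
  have un : cabs (u n - z0) < r.
    apply: le_lt_trans IH2 _; apply: le_lt_trans kr.
    by apply: ler_piMr; [rewrite mulr_ge0|rewrite gerBl ltW].
  have un1 : cabs (u n.+1 - z0) < r.
    apply: le_lt_trans IH3 _; apply: le_lt_trans kr.
    by apply: ler_piMr; [rewrite mulr_ge0|rewrite gerBl exprn_ge0// invr_ge0].
  have -> : u n.+2 - u n.+1 = - (F (u n.+1) - F (u n) - d * (u n.+1 - u n)) / d.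
    have -> : u n.+2 - u n.+1 = T (u n.+1) - T (u n) by [].
    by rewrite /T; field.
  rewrite cabsM cabsN cabsV ler_pdivrMr//.
  apply: le_trans (hF _ _ un1 un) _; rewrite exprS.
  have := ler_wpM2l (ltW dp) IH1; lra.
have [|l ul] := @geometric_ctends u k 2^-1 _ (fun n => (main n).1).
  by apply/andP; split; [rewrite invr_ge0|rewrite invf_lt1// ltr1n].
have lz : cabs (l - z0) <= 2 * k.
  apply: (ctends_le ul); near=> n; apply: le_trans (main n).2 _.
  by apply: ler_piMr; [rewrite mulr_ge0|rewrite gerBl exprn_ge0// invr_ge0].
exists l; first by rewrite kE; have := ler_wpM2l (ltW dp) lz; lra.
have lr := le_lt_trans lz kr.
apply/eqP; rewrite -subr_eq0 -cabs_eq0 eq_le cabs_ge0 andbT.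
apply/ler_addgt0Pr => e e0; rewrite add0r.
have e1 : 0 < e / (4 * cabs d) by rewrite divr_gt0// mulr_gt0.
(* [F (u n) - z] is [d] times the displacement of step [n], so it tends to 0. *)
have ul1 : ctends (fun n => u n.+1) l.
  by apply/ctendsP; rewrite (cvg_shiftS u); apply/ctendsP.
have [n [/= h1 h2]] := filter_ex (filterI (ul _ e1) (ul1 _ e1)).
have un : cabs (u n - z0) < r.
  apply: le_lt_trans (main n).2 _; apply: le_lt_trans kr.
  by apply: ler_piMr; [rewrite mulr_ge0|rewrite gerBl exprn_ge0// invr_ge0].
have -> : F l - z = (F l - F (u n) - d * (l - u n)) + d * (l - u n.+1).
  by rewrite /u /= -/(u n) /T; field.
apply: le_trans (cabsD _ _) _; rewrite cabsM.
have := hF _ _ lr un; rewrite (cabsB l (u n)) (cabsB l (u n.+1)) => h3.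
have := ler_wpM2l (ltW dp) (ltW h1); have := ler_wpM2l (ltW dp) (ltW h2).
have -> : cabs d * (e / (4 * cabs d)) = e / 4 by field; rewrite lt0r_neq0.
lra.
Unshelve. all: by end_near. Qed.

(** [phi z] is the solution found by Newton's iteration. The bound on its
    distance to [z0] makes [phi] continuous at [F z0]; the strict estimate for
    [F] at [z0], read backwards, is then the strict estimate for [phi]. *)
Lemma local_inverse F z0 d (V : set C) : sderiv F z0 d -> d != 0 -> nbhs z0 V ->
  exists phi : C -> C, [/\ phi (F z0) = z0, sderiv phi (F z0) d^-1 &
    \forall z \near F z0, V (phi z) /\ F (phi z) = z].
Proof.
move=> Fd d0 /nbhsC[r1 r10 hV]; have dp : 0 < cabs d by rewrite cabs_gt0.
have d2 : 0 < cabs d / 2 by rewrite divr_gt0.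
have [r2 r20 hF] := Fd _ d2; pose r := Num.min r1 r2.
have r0 : 0 < r by rewrite lt_min r10.
have hr1 a : cabs (a - z0) < r -> cabs (a - z0) < r1.
  by rewrite lt_min => /andP[].
have hr2 a : cabs (a - z0) < r -> cabs (a - z0) < r2.
  by rewrite lt_min => /andP[].
have hF' a b : cabs (a - z0) < r -> cabs (b - z0) < r ->
     cabs (F a - F b - d * (a - b)) <= cabs d / 2 * cabs (a - b).
  by move=> /hr2 ? /hr2 ?; exact: hF.
have : forall z, exists w, 2 * cabs (z - F z0) < cabs d * r ->
    cabs d * cabs (w - z0) <= 2 * cabs (z - F z0) /\ F w = z.
  move=> z; have [h|h] := ltP (2 * cabs (z - F z0)) (cabs d * r); last by exists 0.
  by have [w ? ?] := newton d0 r0 hF' h; exists w.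
move=> /choice[phi hphi].
have near0 : \forall z \near F z0, 2 * cabs (z - F z0) < cabs d * r.
  apply/nearC; exists (cabs d * r / 2); first by rewrite divr_gt0// mulr_gt0.
  move=> w; lra.
have hb z s : 2 * cabs (z - F z0) < cabs d * r -> 2 * cabs (z - F z0) < cabs d * s ->
    cabs (phi z - z0) < s.
  by move=> /hphi[h _] h'; rewrite -(ltr_pM2l dp); apply: le_lt_trans h h'.
exists phi; split.
- have := hphi (F z0); rewrite subrr cabs0 mulr0 => /(_ (mulr_gt0 dp r0))[h _].
  apply/eqP; rewrite -subr_eq0 -cabs_eq0 eq_le cabs_ge0 andbT.
  by rewrite -(pmulr_rle0 _ dp).
- move=> e e0.
  have e10 : 0 < Num.min (cabs d / 2) (e * cabs d ^+ 2 / 2).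
    by rewrite lt_min d2 divr_gt0// mulr_gt0// exprn_gt0.
  set e1 := Num.min _ _ in e10.
  have [s s0 hs] := Fd _ e10.
  exists (cabs d * Num.min r s / 2).
    by rewrite divr_gt0// mulr_gt0// lt_min r0.
  have aux x : cabs (x - F z0) < cabs d * Num.min r s / 2 ->
      2 * cabs (x - F z0) < cabs d * r /\ 2 * cabs (x - F z0) < cabs d * s.
    move=> h; have h2 : 2 * cabs (x - F z0) < cabs d * Num.min r s by lra.
    by split; apply: lt_le_trans h2 _; rewrite ler_pM2l// ge_min lexx ?orbT.
  move=> a b /aux[ar as_] /aux[br bs].
  have [[_ Fa] [_ Fb]] := (hphi _ ar, hphi _ br).
  have := hs _ _ (hb _ _ ar as_) (hb _ _ br bs); rewrite Fa Fb => h.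
  set D := phi a - phi b in h *.
  have h1 : cabs (a - b - d * D) <= cabs d / 2 * cabs D.
    by apply: le_trans h _; rewrite ler_wpM2r ?cabs_ge0// ge_min lexx.
  have h2 : cabs (a - b - d * D) <= e * cabs d ^+ 2 / 2 * cabs D.
    by apply: le_trans h _; rewrite ler_wpM2r ?cabs_ge0// ge_min lexx orbT.
  have h3 : cabs d * cabs D <= 2 * cabs (a - b).
    have := cabsBD (d * D) (a - b); rewrite (cabsB (d * D)) cabsM; lra.
  have -> : D - d^-1 * (a - b) = - (a - b - d * D) / d by field.
  rewrite cabsM cabsN cabsV ler_pdivrMr//; apply: le_trans h2 _.
  have := ler_wpM2l (mulr_ge0 (ltW e0) (ltW dp)) h3; lra.
- apply: filterS near0 => z hz; have [h Fz] := hphi _ hz; split=> //.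
  by apply/hV/hr1/hb.
Qed.

(** Injectivity forces [phi] to coincide near [F z0] with the local inverse
    obtained from Newton's iteration. *)
Lemma sderiv_inverse F z0 d (phi : C -> C) (V : set C) : sderiv F z0 d -> d != 0 ->
  nbhs z0 V -> (forall a b, V a -> V b -> F a = F b -> a = b) ->
  (\forall z \near F z0, V (phi z) /\ F (phi z) = z) ->
  sderiv phi (F z0) d^-1.
Proof.
move=> Fd d0 V0 injV hphi; have [psi [_ psid hpsi]] := local_inverse Fd d0 V0.
apply: sderiv_ext psid; apply: filterS2 hphi hpsi => z [V1 F1] [V2 F2].
by apply: injV; rewrite ?F1.
Qed.

End LocalInverse.

(** * Power series *)

Section PowerSeries.
Variable R : realType.
Local Notation C := R[i].
Implicit Types (z w x y d l h : C) (e r s M K q : R) (a : nat -> C) (f g : C -> C).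

Lemma ctendsD (u v : nat -> C) l l' : ctends u l -> ctends v l' ->
  ctends (fun n => u n + v n) (l + l').
Proof.
move=> ul vl e e0; have e2 : 0 < e / 2 by rewrite divr_gt0.
apply: filterS2 (ul _ e2) (vl _ e2) => n hu hv.
by rewrite opprD addrACA; apply: le_lt_trans (cabsD _ _) _; lra.
Qed.

Lemma ctendsZ (u : nat -> C) c l : ctends u l -> ctends (fun n => c * u n) (c * l).
Proof.
move=> ul e e0; have c0 : 0 < cabs c + 1 by rewrite ltr_wpDl ?cabs_ge0.
have e1 : 0 < e / (cabs c + 1) by rewrite divr_gt0.
apply: filterS (ul _ e1) => n h; rewrite -mulrBr cabsM.
apply: le_lt_trans (_ : _ <= (cabs c + 1) * cabs (u n - l)) _.
  by apply: ler_wpM2r; rewrite ?cabs_ge0// lerDl.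
by rewrite mulrC -ltr_pdivlMr.
Qed.

Lemma ctends_shift (u : nat -> C) l : ctends u l -> ctends (fun n => u n.+1) l.
Proof. by move=> h; apply/ctendsP; rewrite (cvg_shiftS u); apply/ctendsP. Qed.

Lemma ctends_unshift (u : nat -> C) l : ctends (fun n => u n.+1) l -> ctends u l.
Proof. by move=> h; apply/ctendsP; rewrite -(cvg_shiftS u); apply/ctendsP. Qed.

Lemma ctends_cst l : ctends (fun=> l) l.
Proof. by move=> e e0; apply: nearW => n; rewrite subrr cabs0. Qed.

Definition pser a f r := forall z, cabs z < r ->
  ctends (series (fun k => a k * z ^+ k)) (f z).

(** This bound is what survives termwise differentiation, at the cost of a
    smaller radius, and it gives absolute convergence on every smaller
    disk. *)
Definition coef_bdd a r := exists M, forall k, cabs (a k) * r ^+ k <= M.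

Definition dcoef a := fun k => k.+1%:R * a k.+1.

Lemma ctends_bounded (u : nat -> C) l : ctends u l ->
  exists M, forall n, cabs (u n) <= M.
Proof.
move=> /(_ 1 ltr01)[N _ hN]; exists (cabs l + 1 + \sum_(k < N) cabs (u k)) => n.
have S0 : 0 <= \sum_(k < N) cabs (u k) by apply: sumr_ge0 => k _; exact: cabs_ge0.
have [nN|Nn] := ltnP n N.
  rewrite (bigD1 (Ordinal nN))//= addrCA lerDl.
  rewrite addr_ge0//; first by rewrite addr_ge0 ?cabs_ge0.
  by apply: sumr_ge0 => k _; exact: cabs_ge0.
have := hN n Nn; have := cabsBD (u n) l => /= h1 h2.
by rewrite -[cabs (u n)]addr0 lerD//; lra.
Qed.

Lemma pser_bdd a f r s : pser a f r -> 0 < s < r -> coef_bdd a s.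
Proof.
move=> af /andP[s0 sr]; have sE : cabs s%:C%C = s by rewrite cabs_real gtr0_norm.
have := af s%:C%C; rewrite sE => /(_ sr) /ctends_bounded[M hM].
exists (M + M) => k; rewrite -[X in X ^+ k]sE -cabsX -cabsM.
have -> : a k * s%:C%C ^+ k = series (fun k => a k * s%:C%C ^+ k) k.+1 -
    series (fun k => a k * s%:C%C ^+ k) k.
  by rewrite /series /= big_nat_recr//= addrAC subrr add0r.
by apply: le_trans (cabsD _ _) _; rewrite cabsN lerD.
Qed.

(** [q ^ n] is the smallest of the [n + 1] terms of a geometric sum that is at
    most [(1 - q)^-1]. *)
Lemma natr_geometric_le q n : 0 <= q < 1 -> n.+1%:R * q ^+ n <= (1 - q)^-1.
Proof.
move=> /andP[q0 q1]; have p0 : 0 < 1 - q by rewrite subr_gt0.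
rewrite -[leRHS]mul1r ler_pdivlMr//.
apply: le_trans (_ : _ <= 1 - q ^+ n.+1) _; last by rewrite gerBl exprn_ge0.
elim: n => [|n IH]; first by rewrite expr0 expr1 !mul1r.
have h : 0 <= (1 - q) * (1 - q ^+ n.+1).
  by apply: mulr_ge0; [exact: ltW|rewrite subr_ge0 exprn_ile1// ltW].
have := ler_wpM2l q0 IH; move: h; rewrite -(natr1 n.+1) !exprS; lra.
Qed.

Lemma coef_bdd_dcoef a r s : coef_bdd a r -> 0 <= s < r -> coef_bdd (dcoef a) s.
Proof.
move=> [M hM] /andP[s0 sr]; have r0 : 0 < r := le_lt_trans s0 sr.
have q01 : 0 <= s / r < 1 by rewrite divr_ge0 ?(ltW r0)//= ltr_pdivrMr// mul1r.
have q1 : 0 < 1 - s / r by rewrite subr_gt0; case/andP: q01.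
exists (M / r / (1 - s / r)) => k; rewrite /dcoef cabsM cabs_nat.
have -> : k.+1%:R * cabs (a k.+1) * s ^+ k =
    (cabs (a k.+1) * r ^+ k.+1) / r * (k.+1%:R * (s / r) ^+ k).
  by rewrite exprS expr_div_n; field; rewrite ?expf_neq0 ?lt0r_neq0.
apply: ler_pM.
- by rewrite divr_ge0 ?mulr_ge0 ?cabs_ge0 ?exprn_ge0 ?(ltW r0).
- by rewrite mulr_ge0// exprn_ge0//; case/andP: q01.
- by rewrite ler_pM2r ?invr_gt0.
- exact: natr_geometric_le.
Qed.

Lemma coef_bdd_cvg a r z : coef_bdd a r -> cabs z < r ->
  exists l, ctends (series (fun k => a k * z ^+ k)) l.
Proof.
move=> [M hM] zr; have r0 : 0 < r := le_lt_trans (cabs_ge0 z) zr.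
apply: (@geometric_ctends _ _ M (cabs z / r)) => [|n].
  by rewrite divr_ge0 ?cabs_ge0 ?(ltW r0)//= ltr_pdivrMr// mul1r.
rewrite /series /= big_nat_recr//= addrAC subrr add0r cabsM cabsX expr_div_n.
have -> : cabs (a n) * cabs z ^+ n = (cabs (a n) * r ^+ n) * (cabs z ^+ n / r ^+ n).
  by field; rewrite ?expf_neq0 ?lt0r_neq0.
by rewrite ler_wpM2r// divr_ge0 ?exprn_ge0 ?cabs_ge0 ?ltW.
Qed.

Lemma subrXX_le (x y : C) s n : cabs x <= s -> cabs y <= s ->
  cabs (x ^+ n.+1 - y ^+ n.+1) <= n.+1%:R * s ^+ n * cabs (x - y).
Proof.
move=> xs ys; have s0 := le_trans (cabs_ge0 x) xs.
elim: n => [|n IH]; first by rewrite !expr1 expr0 !mul1r.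
have -> : x ^+ n.+2 - y ^+ n.+2 = x * (x ^+ n.+1 - y ^+ n.+1) + (x - y) * y ^+ n.+1.
  by rewrite !(exprS _ n.+1); ring.
apply: le_trans (cabsD _ _) _; rewrite !cabsM cabsX.
have h1 : cabs x * cabs (x ^+ n.+1 - y ^+ n.+1) <=
    s * (n.+1%:R * s ^+ n * cabs (x - y)) by apply: ler_pM; rewrite ?cabs_ge0.
have h2 : cabs (x - y) * cabs y ^+ n.+1 <= cabs (x - y) * s ^+ n.+1.
  by apply: ler_wpM2l; rewrite ?cabs_ge0// lerXn2r ?nnegrE ?cabs_ge0.
apply: le_trans (lerD h1 h2) _; rewrite -(natr1 n.+1) exprS.
by rewrite le_eqVlt; apply/orP; left; apply/eqP; ring.
Qed.

(** The error [E k] of the linear approximation of the [k]-th power satisfies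
    [E (k + 1) = x * E k + O(k * s ^ (k - 1) * e)]; adding up the last terms
    gives the quadratic factor, everything being proportional to the distance
    of [x] and [y]. The derivative is taken at a third point [z] because
    strict differentiability asks for it. *)
Lemma subrXX_deriv_le (x y z : C) s e n : cabs x <= s -> cabs y <= s -> cabs z <= s ->
  cabs (x - z) <= e -> cabs (y - z) <= e ->
  cabs (x ^+ n.+2 - y ^+ n.+2 - n.+2%:R * z ^+ n.+1 * (x - y)) <=
    n.+2%:R * n.+1%:R * s ^+ n * e * cabs (x - y).
Proof.
move=> xs ys zs xz yz; have s0 := le_trans (cabs_ge0 x) xs.
have e0 := le_trans (cabs_ge0 _) xz.
have step k E0 : cabs (x ^+ k.+1 - y ^+ k.+1 - k.+1%:R * z ^+ k * (x - y)) <= E0 ->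
  cabs (x ^+ k.+2 - y ^+ k.+2 - k.+2%:R * z ^+ k.+1 * (x - y)) <=
    s * E0 + 2 * k.+1%:R * s ^+ k * e * cabs (x - y).
  move=> hE.
  have -> : x ^+ k.+2 - y ^+ k.+2 - k.+2%:R * z ^+ k.+1 * (x - y) =
    x * (x ^+ k.+1 - y ^+ k.+1 - k.+1%:R * z ^+ k * (x - y)) +
    (k.+1%:R * z ^+ k * ((x - z) * (x - y)) + (y ^+ k.+1 - z ^+ k.+1) * (x - y)).
    by rewrite !(exprS _ k.+1) (exprS z k) -(natr1 k.+1); ring.
  apply: le_trans (cabsD _ _) _; apply: lerD.
    by rewrite cabsM; apply: ler_pM; rewrite ?cabs_ge0.
  apply: le_trans (cabsD _ _) _.
  have h1 : cabs (k.+1%:R * z ^+ k * ((x - z) * (x - y))) <=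
      k.+1%:R * s ^+ k * (e * cabs (x - y)).
    rewrite !cabsM cabsX cabs_nat; apply: ler_pM.
    - by rewrite mulr_ge0// exprn_ge0// cabs_ge0.
    - by rewrite mulr_ge0// cabs_ge0.
    - by rewrite ler_wpM2l// lerXn2r ?nnegrE ?cabs_ge0.
    - by rewrite ler_wpM2r ?cabs_ge0.
  have h2 : cabs ((y ^+ k.+1 - z ^+ k.+1) * (x - y)) <=
      k.+1%:R * s ^+ k * e * cabs (x - y).
    rewrite cabsM ler_wpM2r ?cabs_ge0//; apply: le_trans (subrXX_le _ ys zs) _.
    by rewrite ler_wpM2l// mulr_ge0// exprn_ge0.
  lra.
elim: n => [|n IH].
  have h : cabs (x ^+ 1 - y ^+ 1 - 1%:R * z ^+ 0 * (x - y)) <= 0.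
    by rewrite !expr1 expr0 mulr1 mul1r subrr cabs0.
  by have := step 0%N 0 h; rewrite mulr0 add0r.
apply: le_trans (step _ _ IH) _; rewrite exprS -(natr1 n.+2) -(natr1 n.+1).
by rewrite le_eqVlt; apply/orP; left; apply/eqP; ring.
Qed.

Lemma coef_bdd_sum a r s : coef_bdd a r -> 0 <= s < r ->
  exists2 K, 0 <= K & forall n, \sum_(0 <= k < n) cabs (a k) * s ^+ k <= K.
Proof.
move=> [M hM] /andP[s0 sr]; have r0 : 0 < r := le_lt_trans s0 sr.
have M0 : 0 <= M by apply: le_trans (hM 0%N); rewrite expr0 mulr1 cabs_ge0.
have q1 : 0 < 1 - s / r by rewrite subr_gt0 ltr_pdivrMr// mul1r.
have q0 : 0 <= s / r by rewrite divr_ge0// (ltW r0).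
exists (M / (1 - s / r)) => [|n]; first by rewrite divr_ge0 ?(ltW q1).
apply: le_trans (_ : _ <= \sum_(0 <= k < n) M * (s / r) ^+ k) _.
  apply: ler_sum => k _.
  have -> : cabs (a k) * s ^+ k = (cabs (a k) * r ^+ k) * (s / r) ^+ k.
    by rewrite expr_div_n; field; rewrite ?expf_neq0 ?lt0r_neq0.
  by rewrite ler_wpM2r// exprn_ge0.
rewrite -big_distrr /= ler_wpM2l// -[leRHS]mul1r ler_pdivlMr//.
apply: le_trans (_ : _ <= 1 - (s / r) ^+ n) _; last by rewrite gerBl exprn_ge0.
rewrite le_eqVlt; apply/orP; left; apply/eqP.
elim: n => [|n IH]; first by rewrite big_geq// mul0r expr0 subrr.
by rewrite big_nat_recr//= mulrDl IH exprS; ring.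
Qed.

(** Summing the estimates for the monomials, the constants form a partial sum
    of the twice derived series, which is bounded at a radius between [cabs z]
    and [r]. *)
Lemma pser_sderiv a f g r z : pser a f r -> pser (dcoef a) g r -> cabs z < r ->
  sderiv f z (g z).
Proof.
move=> af ag zr; set n := cabs z in zr; have n0 : 0 <= n := cabs_ge0 z.
(* [n < s < s1 < s2 < s3 < r]: each derived series gives up some radius. *)
pose s := (3 * n + r) / 4; pose s1 := (2 * n + 2 * r) / 4.
pose s2 := (n + 3 * r) / 4; pose s3 := (n + 7 * r) / 8.
have b3 : coef_bdd a s3 by apply: (pser_bdd af); rewrite /s3; apply/andP; split; lra.
have b2 : coef_bdd (dcoef a) s2.
  by apply: (coef_bdd_dcoef b3); rewrite /s3 /s2; apply/andP; split; lra.
have b1 : coef_bdd (dcoef (dcoef a)) s1.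
  by apply: (coef_bdd_dcoef b2); rewrite /s1 /s2; apply/andP; split; lra.
have [K K0 hK] : exists2 K, 0 <= K &
    forall n, \sum_(0 <= k < n) cabs (dcoef (dcoef a) k) * s ^+ k <= K.
  by apply: (coef_bdd_sum b1); rewrite /s1 /s; apply/andP; split; lra.
have s0 : 0 <= s by rewrite /s; lra.
have ns : n < s by rewrite /s; lra.
have main x y e : cabs x <= s -> cabs y <= s -> cabs (x - z) <= e ->
    cabs (y - z) <= e -> cabs (f x - f y - g z * (x - y)) <= K * e * cabs (x - y).
  move=> xs ys xz yz; have e0 := le_trans (cabs_ge0 _) xz.
  have sr : s < r by rewrite /s; lra.
  have lim : ctends (fun N => series (fun k => a k * x ^+ k) N.+2 +
      (-1) * series (fun k => a k * y ^+ k) N.+2 +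
      (- (x - y)) * series (fun k => dcoef a k * z ^+ k) N.+1)
      (f x + (-1) * f y + (- (x - y)) * g z).
    apply: ctendsD; last exact: ctendsZ _ (ctends_shift (ag z zr)).
    apply: ctendsD; first exact: ctends_shift (ctends_shift (af x (le_lt_trans xs sr))).
    exact: ctendsZ _ (ctends_shift (ctends_shift (af y (le_lt_trans ys sr)))).
  have -> : f x - f y - g z * (x - y) =
    f x + (-1) * f y + (- (x - y)) * g z - 0 by ring.
  apply: (ctends_le lim); apply: nearW => N; rewrite subr0.
  have -> : series (fun k => a k * x ^+ k) N.+2 +
      (-1) * series (fun k => a k * y ^+ k) N.+2 +
      (- (x - y)) * series (fun k => dcoef a k * z ^+ k) N.+1 =
      \sum_(0 <= k < N) a k.+2 *
        (x ^+ k.+2 - y ^+ k.+2 - k.+2%:R * z ^+ k.+1 * (x - y)).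
    rewrite /series /=; elim: N => [|N IH].
      by rewrite !big_nat_recr//= !big_geq// /dcoef; ring.
    rewrite (big_nat_recr N.+2)//= [X in _ + -1 * X](big_nat_recr N.+2)//=.
    rewrite [X in - (x - y) * X](big_nat_recr N.+1)//= [RHS]big_nat_recr//= -IH /dcoef.
    by ring.
  have sum_le m (u : nat -> C) : cabs (\sum_(0 <= k < m) u k) <=
      \sum_(0 <= k < m) cabs (u k).
    elim: m => [|m IH]; first by rewrite !big_geq// cabs0.
    by rewrite !big_nat_recr//=; apply: le_trans (cabsD _ _) _; rewrite lerD2r.
  apply: le_trans (sum_le _ _) _; rewrite -mulrA.
  apply: le_trans (_ : _ <= (\sum_(0 <= k < N) cabs (dcoef (dcoef a) k) * s ^+ k) *
    (e * cabs (x - y))) _; last by rewrite ler_wpM2r// mulr_ge0// cabs_ge0.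
  rewrite big_distrl /=; apply: ler_sum => k _; rewrite cabsM.
  apply: le_trans (ler_wpM2l (cabs_ge0 _)
    (subrXX_deriv_le _ xs ys (ltW ns) xz yz)) _.
  rewrite /dcoef !cabsM !cabs_nat le_eqVlt; apply/orP; left; apply/eqP; ring.
move=> e e0; have K1 : 0 < K + 1 by rewrite ltr_wpDl.
exists (Num.min (s - n) (e / (K + 1))); first by rewrite lt_min subr_gt0 ns divr_gt0.
move=> x y; rewrite !lt_min => /andP[x1 x2] /andP[y1 y2].
have xs : cabs x <= s by have := cabsBD x z; rewrite -/n; lra.
have ys : cabs y <= s by have := cabsBD y z; rewrite -/n; lra.
apply: le_trans (main _ _ _ xs ys (ltW x2) (ltW y2)) _.
rewrite ler_wpM2r ?cabs_ge0// mulrA ler_pdivrMr// mulrC.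
by rewrite ler_pM2l// lerDl.
Qed.

Lemma pser_deriv a f r : pser a f r -> exists g, pser (dcoef a) g r /\
  forall z, cabs z < r -> sderiv f z (g z).
Proof.
move=> af.
have : forall z, exists l, cabs z < r ->
    ctends (series (fun k => dcoef a k * z ^+ k)) l.
  move=> z; have [zr|zr] := ltP (cabs z) r; last by exists 0.
  have n0 := cabs_ge0 z.
  have bd : coef_bdd a ((cabs z + 3 * r) / 4).
    by apply: (pser_bdd af); apply/andP; split; lra.
  have bd' : coef_bdd (dcoef a) ((cabs z + r) / 2).
    by apply: (coef_bdd_dcoef bd); apply/andP; split; lra.
  have [|l hl] := @coef_bdd_cvg _ _ z bd'; first by lra.
  by exists l.
move=> /choice[g hg]; exists g; split=> // z zr; exact: pser_sderiv af hg zr.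
Qed.

Lemma pser_hol k a f r : pser a f r -> hol k [set z | cabs z < r] f.
Proof.
elim: k a f => [|k IH] a f af; have [g [ag fg]] := pser_deriv af.
  by move=> z /fg/sderiv_cont.
by exists g => //; exact: IH ag.
Qed.

Lemma pser0 a f r : 0 < r -> pser a f r -> f 0 = a 0%N.
Proof.
move=> r0 /(_ 0); rewrite cabs0 => /(_ r0) h.
apply: (ctends_unique (ctends_shift h)).
have -> : (fun n => series (fun k => a k * 0 ^+ k) n.+1) = (fun=> a 0%N).
  apply/funext => n; rewrite /series /= big_nat_recl//= expr0 mulr1 big1 ?addr0//.
  by move=> k _; rewrite exprS mul0r mulr0.
exact: ctends_cst.
Qed.

Lemma pser_shift a f r : pser a f r -> exists g, pser (fun k => a k.+1) g r /\
  forall z, cabs z < r -> f z = a 0%N + z * g z.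
Proof.
move=> af; exists (fun z => if z == 0 then a 1%N else (f z - a 0%N) / z); split.
  move=> z zr; case: eqVneq => [->|z0].
    apply: ctends_unshift.
    have -> : (fun n => series (fun k => a k.+1 * 0 ^+ k) n.+1) = (fun=> a 1%N).
      apply/funext => n; rewrite /series /= big_nat_recl//= expr0 mulr1 big1 ?addr0//.
      by move=> k _; rewrite exprS mul0r mulr0.
    exact: ctends_cst.
  have h := ctendsZ z^-1 (ctendsD (ctends_shift (af z zr)) (ctends_cst (- a 0%N))).
  rewrite [_ / z]mulrC; move: h; congr ctends; apply/funext => n.
  rewrite /series /= big_nat_recl//= expr0 mulr1 addrAC subrr add0r big_distrr /=.
  by apply: eq_bigr => k _; rewrite exprS; field.
move=> z zr; case: eqVneq => [->|z0]; last by field.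
rewrite mul0r addr0; apply: pser0 af; apply: le_lt_trans zr; exact: cabs_ge0.
Qed.

End PowerSeries.

(** * The derivative of an injective analytic function *)

Section InjectiveDerivative.
Variable R : realType.
Local Notation C := R[i].
Implicit Types (z w x y d l h : C) (e r s : R) (a : nat -> C) (f g : C -> C).

Lemma pser_shiftn a f r n : pser a f r -> exists g, pser (fun k => a (n + k)%N) g r /\
  forall z, cabs z < r -> f z = \sum_(i < n) a i * z ^+ i + z ^+ n * g z.
Proof.
move=> af; elim: n => [|n [g [ag fg]]].
  by exists f; split=> // z _; rewrite big_ord0 add0r expr0 mul1r.
have [g' [ag' gg']] := pser_shift ag; exists g'; split.
  by rewrite (_ : (fun k => a (n.+1 + k)%N) = (fun k => a (n + k.+1)%N))//;
    apply/funext => k; rewrite addnS.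
move=> z zr; rewrite fg// gg'// addn0 big_ord_recr /= exprS; ring.
Qed.

Lemma sderivX n z : sderiv (fun w : C => w ^+ n.+1) z (n.+1%:R * z ^+ n).
Proof.
elim: n => [|n IH]; first by rewrite expr0 mulr1; exact: sderiv_id.
have := sderivM (@sderiv_id R z) IH.
rewrite (_ : _ + _ = n.+2%:R * z ^+ n.+1); last first.
  by rewrite mul1r exprS -(natr1 n.+1); ring.
by apply: sderiv_ext; apply/nearC; exists 1 => // w _; rewrite exprS.
Qed.

(** A root of [1 + X + ... + X^(n-1)], which does not vanish at 1 in
    characteristic zero. *)
Lemma unity_root_neq1 n : (1 < n)%N -> exists2 z : C, z ^+ n = 1 & z != 1.
Proof.
case: n => [//|[//|n]] _; pose p : {poly C} := \poly_(i < n.+2) 1.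
have sp : size p = n.+2 by rewrite size_poly_eq// oner_neq0.
have /closed_rootP[z /rootP] : size p != 1%N by rewrite sp.
rewrite horner_poly => h.
have hz : z ^+ n.+2 - 1 = 0.
  rewrite subrX1 (_ : \sum_(i < n.+2) z ^+ i = 0) ?mulr0// -[RHS]h.
  by apply: eq_bigr => i _; rewrite mul1r.
exists z; first by apply/eqP; rewrite -subr_eq0 hz.
apply/eqP => z1; move: h; rewrite z1; under eq_bigr do rewrite expr1n mul1r.
by rewrite sumr_const card_ord => /eqP; rewrite pnatr_eq0.
Qed.

(** Otherwise [f = a 0 + phi ^ j] near 0, where [j >= 2] is the index of the
    first nonzero higher coefficient and [phi h = h * rho (g h)], with [rho] a
    local [j]-th root. The derivative of [phi] at 0 is not 0, so [phi] takes
    all small values; points where it takes the values [t] and [z * t], with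
    [z ^ j = 1] and [z] different from 1, have the same image under [f]. *)
Lemma pser_inj_coef1 a f r : 0 < r -> pser a f r ->
  (forall x y, cabs x < r -> cabs y < r -> f x = f y -> x = y) -> a 1%N != 0.
Proof.
move=> r0 af inj; apply/negP => /eqP a1.
have exj : exists j, (0 < j)%N && (a j != 0).
  apply: contrapT => /forallNP h.
  have a0 k : a k.+1 = 0 by apply/eqP; apply: contrapT => /negP hk; exact: (h k.+1).
  have [g [ag fg]] := pser_shift af.
  have g0 z : cabs z < r -> g z = 0.
    move=> zr; apply: (ctends_unique (ag z zr)).
    rewrite (_ : series _ = fun=> 0); first exact: ctends_cst.
    by apply/funext => n; rewrite /series /= big1// => k _; rewrite a0 mul0r.
  have r2 : cabs (r / 2)%:C%C < r.
    by rewrite cabs_real gtr0_norm ?divr_gt0//; lra.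
  have /inj : f (r / 2)%:C%C = f 0.
    by rewrite fg// (fg 0) ?cabs0// g0// mulr0 mul0r.
  rewrite cabs0 => /(_ r2 r0) [] /eqP; rewrite mulf_eq0 invr_eq0 pnatr_eq0 orbF.
  by rewrite (gt_eqF r0).
case: (ex_minnP exj) => j /andP[j0 aj0] minj.
have j1 : (1 < j)%N.
  by rewrite ltn_neqAle j0 andbT; apply/eqP => j1; move: aj0; rewrite -j1 a1 eqxx.
have [g [ag fg0]] := pser_shiftn j af.
have g0 : g 0 = a j by rewrite (pser0 r0 ag) addn0.
have fg z : cabs z < r -> f z = a 0%N + z ^+ j * g z.
  move=> zr; rewrite fg0//; congr (_ + _); case: j j0 minj {j1 aj0 ag fg0 g0} => // j _ minj.
  rewrite big_ord_recl expr0 mulr1 big1 ?addr0// => i _ /=.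
  suff -> : a (bump 0 i) = 0 by rewrite mul0r.
  apply/eqP; apply: contrapT => /negP hk; have := minj (bump 0 i); rewrite hk.
  by rewrite /bump /= add1n => /(_ isT); rewrite ltnS leqNgt ltn_ord.
have gc : ccont g 0 by apply: (hol_cont (pser_hol 0 ag)); rewrite /mkset cabs0.
have [gd [_ gder]] := pser_deriv ag.
have := gder 0; rewrite cabs0 => /(_ r0) {gder}gder.
(* [rho] is the inverse of the [j]-th power near [a j = b ^ j]. *)
pose b := j.-root (a j); have bj : b ^+ j = a j by rewrite rootCK.
have b0 : b != 0 by apply/eqP => b0; move: aj0; rewrite -bj b0 expr0n gtn_eqF// eqxx.
case: j => [//|j] in j0 aj0 minj j1 ag fg0 g0 fg b bj b0 *.
have db0 : j.+1%:R * b ^+ j != 0 by rewrite mulf_neq0 ?pnatr_eq0 ?expf_neq0.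
have [rho [rhob rhod hrho]] := local_inverse (sderivX j b) db0 (filterT : nbhs b setT).
rewrite bj -g0 in rhob rhod hrho.
pose phi h := h * rho (g h).
have := sderivM (@sderiv_id R 0) (sderiv_comp rhod gder).
rewrite mul0r addr0 mul1r rhob => phid.
pose V := [set h | cabs h < r /\ phi h ^+ j.+1 = f h - a 0%N].
have V0 : nbhs 0 V.
  have /nearC[e e0 he] := hrho.
  have hr : \forall h \near (0 : C), cabs h < r.
    by apply/nearC; exists r => // w; rewrite subr0.
  apply: filterS2 hr (gc _ e0) => h hr /he[_ hg]; split=> //.
  by rewrite /phi exprMn hg fg//; ring.
have [psi [_ _ hpsi0]] := @local_inverse R phi 0 b V phid b0 V0.
have phi0 : phi 0 = 0 by rewrite /phi mul0r.
move: hpsi0; rewrite phi0 => /nearC[e e0 hpsi].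
have [z zj z1] := unity_root_neq1 j1.
have cz : 0 < cabs z + 1 by rewrite ltr_wpDl ?cabs_ge0.
(* Small enough for both [t] and [t * z] to be values of [phi]. *)
pose t := e / 2 / (cabs z + 1); have t0 : 0 < t by rewrite !divr_gt0.
have tE : cabs t%:C%C = t by rewrite cabs_real gtr0_norm.
have tz : t * (cabs z + 1) = e / 2 by rewrite /t divfK// lt0r_neq0.
have tc0 : t%:C%C != 0 :> C by rewrite -cabs_gt0 tE.
have := mulr_ge0 (ltW t0) (cabs_ge0 z) => tz0.
have [[r1 p1] q1] : V (psi t%:C%C) /\ phi (psi t%:C%C) = t%:C%C.
  by apply: hpsi; rewrite subr0 tE; lra.
have [[r2 p2] q2] : V (psi (t%:C%C * z)) /\ phi (psi (t%:C%C * z)) = t%:C%C * z.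
  by apply: hpsi; rewrite subr0 cabsM tE; lra.
have E : psi t%:C%C = psi (t%:C%C * z).
  apply: inj => //.
  apply: (addIr (- a 0%N)); rewrite -p1 -p2 q1 q2 exprMn zj mulr1.
  done.
move: q2; rewrite -E q1 => /esym/eqP; rewrite -subr_eq0 -{2}[t%:C%C]mulr1 -mulrBr.
by rewrite mulf_eq0 (negPf tc0) subr_eq0 (negPf z1).
Qed.

Lemma analytic_pser f w : analytic_at f w -> exists a r, 0 < r /\
  pser a (fun h => f (w + h)) r.
Proof.
move=> [a [t [/gt0_complex[r r0 ->] h]]]; exists a, r; split=> // z zr.
apply/ctendsP; have := h (w + z); rewrite addrAC subrr add0r.
by apply; rewrite -cabs_lt_norm.
Qed.

Lemma analytic_at_ccont f w : analytic_at f w -> ccont f w.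
Proof.
move=> /analytic_pser[a [r [r0 ar]]] e e0.
have B0 : [set z : C | cabs z < r] 0 by rewrite /mkset cabs0.
have /nearC[d d0 hd] := hol_cont (pser_hol 0 ar) B0 e0.
apply/nearC; exists d => // x xd.
by have := hd (x - w); rewrite subr0 (addrC w (x - w)) subrK addr0 => /(_ xd).
Qed.

(** Local form in which injectivity and analyticity of the boundary
    parametrization are used: smooth to all orders, with a nonzero derivative
    at the centre. *)
Lemma analytic_inj f w (N : set C) : open N -> N w -> analytic_at f w ->
  (forall x y, N x -> N y -> f x = f y -> x = y) ->
  exists r, [/\ 0 < r, (forall z, cabs (z - w) < r -> N z),
    (forall k, hol k [set z | cabs (z - w) < r] f) &
    exists2 d, d != 0 & sderiv f w d].
Proof.
move=> oN Nw /analytic_pser[a [r [r0 ar]]] inj.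
have /nbhsC[r1 r10 hN] : nbhs w N by exact: open_nbhs_nbhs.
pose s := Num.min r r1; have s0 : 0 < s by rewrite lt_min r0.
have sr : s <= r by rewrite ge_min lexx.
have sr1 : s <= r1 by rewrite ge_min lexx orbT.
have as_ : pser a (fun h => f (w + h)) s by move=> z zs; apply/ar/(lt_le_trans zs).
have hb z : cabs (z - w) < s -> N z by move=> h; apply/hN/(lt_le_trans h).
have a10 : a 1%N != 0.
  apply: (pser_inj_coef1 s0 as_) => x y xs ys /inj E; apply: (addrI w); apply: E;
    by apply: hb; rewrite addrAC subrr add0r.
have fE : f = (fun z => f (w + (z - w))) by apply/funext => z; rewrite addrC subrK.
have dsub z : sderiv (fun x : C => x - w) z 1.
  by have := sderivD (@sderiv_id R z) (sderiv_cst (- w) z); rewrite addr0.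
exists s; split=> //.
  move=> k; rewrite fE.
  apply: (@hol_comp R k _ [set z | cabs z < s] (fun h => f (w + h)) (fun z => z - w)).
  - exact: pser_hol as_.
  - by apply: holD; [exact: hol_id|exact: hol_cst].
  - by [].
exists (a 1%N) => //; have [g [ag gd]] := pser_deriv as_.
have := gd 0; rewrite cabs0 (pser0 s0 ag) /dcoef mul1r => /(_ s0) d0.
have := @sderiv_comp R (fun h => f (w + h)) (fun z => z - w) w (a 1%N) 1.
by rewrite subrr mulr1 -fE; apply.
Qed.

End InjectiveDerivative.

(** * Holomorphic functions as maps of the real plane *)

Section Plane.
Variable R : realType.
Local Notation C := R[i].
Local Notation E := 'rV[R]_2.
Local Notation c2r := (@R2_of_complex R).
Implicit Types (z w d : C) (e r h : R) (x y v : E) (g : C -> C) (U A : set C).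

Definition r2c x : C := (x 0 0 +i* x 0 1)%C.

Lemma c2rK : cancel c2r r2c.
Proof. by case=> a b; rewrite /r2c !mxE. Qed.

Lemma r2cK : cancel r2c c2r.
Proof.
move=> x; apply/rowP => i; rewrite mxE; case: i => [[|[|//]] p] /=.
  by congr (x _ _); apply/val_inj.
by congr (x _ _); apply/val_inj.
Qed.

Lemma r2cB x y : r2c (x - y) = r2c x - r2c y.
Proof. by rewrite /r2c !mxE. Qed.

Lemma r2cD x y : r2c (x + y) = r2c x + r2c y.
Proof. by rewrite /r2c !mxE. Qed.

Lemma r2cZ h x : r2c (h *: x) = h%:C%C * r2c x.
Proof. by apply: complex_eq; rewrite ?ReM ?ImM /= !mxE; ring. Qed.

Lemma edotE x y : edot x y = complex.Re ((r2c x)^*%C * r2c y).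
Proof.
rewrite ReM /= mulNr opprK /edot big_ord_recl big_ord1.
by rewrite (_ : lift ord0 ord0 = 1)//; exact/val_inj.
Qed.

Lemma enorm_r2c x : enorm x = cabs (r2c x).
Proof. by rewrite /enorm edotE ReM /= mulNr opprK -!expr2. Qed.

Lemma nbhs_r2c x (P : set E) :
  nbhs x P <-> exists2 e : R, 0 < e & forall y, cabs (r2c y - r2c x) < e -> P y.
Proof.
split.
  move=> /nbhs_ballP[e /= e0 h]; exists e => // y ye; apply: h.
  split=> // i j; rewrite -ball_normE /ball_ /= distrC.
  suff hij : `|y i j - x i j| <= cabs (r2c (y - x)).
    by apply: le_lt_trans hij _; rewrite r2cB.
  rewrite ord1.
  case: j => [[|[|//]] p].
    rewrite (_ : Ordinal p = 0); last exact/val_inj.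
    by apply: le_trans (le_Re_cabs _); rewrite /= !mxE.
  rewrite (_ : Ordinal p = 1); last exact/val_inj.
  by apply: le_trans (le_Im_cabs _); rewrite /= !mxE.
move=> [e e0 h]; apply/nbhs_ballP; exists (e / 2) => /=; first by rewrite divr_gt0.
move=> y hy; apply: h; rewrite -r2cB; apply: le_lt_trans (cabs_le _) _.
case: hy => _ hy; have := hy 0 0; have := hy 0 1; rewrite -!ball_normE /ball_ /= => h1 h2.
by rewrite !mxE distrC [X in _ + X]distrC (splitr e) ltrD.
Qed.

Lemma nbhs_c2r z (P : set E) : nbhs (c2r z) P <-> nbhs z (c2r @^-1` P).
Proof.
split.
  move=> /nbhs_r2c[e e0 h]; apply/nbhsC; exists e => // w we; apply: h.
  by rewrite !c2rK.
move=> /nbhsC[e e0 h]; apply/nbhs_r2c; exists e => // y; rewrite c2rK => /h /=.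
by rewrite r2cK.
Qed.

Lemma nbhs_r2cE x (P : set C) : nbhs (r2c x) P <-> nbhs x (r2c @^-1` P).
Proof.
rewrite -{2}(r2cK x) nbhs_c2r (_ : c2r @^-1` _ = P)//.
by apply/funext => z; rewrite /preimage /= c2rK.
Qed.

Lemma c2r_image U : c2r @` U = r2c @^-1` U.
Proof.
apply/seteqP; split=> [_ [z Uz <-]|x Ux]; first by rewrite /preimage /= c2rK.
by exists (r2c x); rewrite ?r2cK.
Qed.

Lemma open_c2r U : open U -> open (c2r @` U).
Proof.
rewrite c2r_image !openE => oU x Ux; apply/nbhs_r2cE; exact: oU.
Qed.

Lemma continuous_c2r : continuous c2r.
Proof. by move=> z P /nbhs_c2r. Qed.

Lemma connected_c2r U : connected U -> connected (c2r @` U).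
Proof.
move=> cU; apply: connected_continuous_connected => //.
exact/continuous_subspaceT/continuous_c2r.
Qed.

Lemma closure_c2r U : closure (c2r @` U) = c2r @` closure U.
Proof.
apply/seteqP; split=> [x cx|_ [z cz <-]].
  exists (r2c x); last by rewrite r2cK.
  move=> P /nbhs_r2cE/cx[_ [[z Uz <-] Pz]]; exists z; split=> //.
  by move: Pz; rewrite /preimage /= c2rK.
move=> P /nbhs_c2r/cz[w [Uw Pw]]; exists (c2r w); split=> //; by exists w.
Qed.

Lemma interior_c2r U : interior (c2r @` U) = c2r @` interior U.
Proof.
rewrite !c2r_image; apply/seteqP; split=> x /=; rewrite /interior /=.
  by move=> /nbhs_r2cE.
by move=> /nbhs_r2cE.
Qed.

Lemma boundary_c2r U : boundary (c2r @` U) = c2r @` boundary U.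
Proof.
rewrite /boundary closure_c2r interior_c2r !c2r_image.
by apply/seteqP; split.
Qed.

(** The strict estimate at the point, applied to the increment [h *: v], is
    the difference quotient estimate. *)
Lemma is_derive_Re g x v d : sderiv g (r2c x) d ->
  is_derive x v (fun y => complex.Re (g (r2c y))) (complex.Re (d * r2c v)).
Proof.
move=> gd; set G := fun y => _; set D := complex.Re _.
suff H : (fun h => h^-1 *: ((G \o shift x) (h *: v) - G x)) @ 0^' --> D.
  split; first by apply/cvg_ex; exists D.
  exact: cvg_lim H.
apply/cvgrPdist_le => e e0; set n := cabs (r2c v).
have n0 : 0 <= n := cabs_ge0 _; have n1 : 0 < n + 1 by rewrite ltr_wpDl.
have [r r0 hr] := gd (e / (n + 1)) (divr_gt0 e0 n1).
near=> h.
have h0 : h != 0 by near: h; exact: nbhs_dnbhs_neq.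
have hn : cabs (h%:C%C * r2c v) < r.
  rewrite cabsM cabs_real -/n.
  have : `|h| < r / (n + 1).
    by near: h; apply: dnbhs0_lt; rewrite divr_gt0.
  rewrite ltr_pdivlMr// mulrDr mulr1; have := normr_ge0 h; lra.
have := hr (r2c (h *: v + x)) (r2c x).
rewrite subrr cabs0 r2cD r2cZ addrK => /(_ hn r0) H.
rewrite /G /= /shift -[_ *: _]/(_ * _).
have -> : D - h^-1 * (complex.Re (g (r2c (h *: v + x))) - complex.Re (g (r2c x))) =
   - (h^-1 * complex.Re (g (h%:C%C * r2c v + r2c x) - g (r2c x) - d * (h%:C%C * r2c v))).
  rewrite r2cD r2cZ !ReB /D; rewrite mulrCA [complex.Re (h%:C%C * _)]ReM /=; field.
  exact: h0.
rewrite normrN normrM normfV ler_pdivrMl ?normr_gt0//.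
apply: le_trans (le_Re_cabs _) _; apply: le_trans H _.
rewrite cabsM cabs_real -/n mulrCA ler_wpM2l// mulrC mulrA ler_pdivrMr//.
by rewrite mulrC ler_pM2l// lerDl.
Unshelve. all: by end_near. Qed.

Lemma r2c_delta (j : 'I_2) :
  r2c (delta_mx 0 j) = if j == 0 then 1 else 'i%C.
Proof.
by case: j => [[|[|//]] p]; apply: complex_eq; rewrite /= !mxE.
Qed.

(** Components and partial derivatives of a complex map are both real parts,
    taken after multiplication by the conjugate of one of these numbers or by
    one of them; so only real parts have to be differentiated. *)
Definition dirc (j : 'I_2) : C := if j == 0 then 1 else 'i%C.

Lemma partial_Re j g x d : sderiv g (r2c x) d ->
  partial j (fun y => complex.Re (g (r2c y))) x = complex.Re (d * dirc j).
Proof.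
by move=> /(is_derive_Re (delta_mx 0 j)) h; rewrite /partial derive_val r2c_delta.
Qed.

Lemma partial_ext (V : set E) j (f1 f2 : E -> R) : open V ->
  (forall x, V x -> f1 x = f2 x) -> forall x, V x ->
  (derivable f1 x (delta_mx 0 j) -> derivable f2 x (delta_mx 0 j)) /\
  partial j f1 x = partial j f2 x.
Proof.
move=> oV ff x Vx.
have nx : \forall y \near x, f1 y = f2 y.
  by apply: filterS ff (open_nbhs_nbhs _); split.
have v0 : delta_mx 0 j != 0 :> E.
  by apply/eqP => /matrixP/(_ 0 j)/eqP; rewrite !mxE !eqxx oner_eq0.
split; last exact: near_eq_derive.
by apply: near_eq_derivable.
Qed.

Lemma Ck_ext (V : set E) k (f1 f2 : E -> R) : open V ->
  (forall x, V x -> f1 x = f2 x) -> Ck k V f1 -> Ck k V f2.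
Proof.
move=> oV; elim: k f1 f2 => [|k IH] f1 f2 ff /=.
all: have cc : (forall x, V x -> {for x, continuous f1}) ->
  forall x, V x -> {for x, continuous f2}.
- move=> c1 x Vx P; rewrite -ff// => /(c1 x Vx) /=; rewrite !nbhs_simpl /=.
  have : \forall y \near x, f1 y = f2 y.
    by apply: filterS ff (open_nbhs_nbhs _); split.
  by apply: filterS2 => y /= ->.
- by move=> [/cc].
- move=> c1 x Vx P; rewrite -ff// => /(c1 x Vx) /=; rewrite !nbhs_simpl /=.
  have : \forall y \near x, f1 y = f2 y.
    by apply: filterS ff (open_nbhs_nbhs _); split.
  by apply: filterS2 => y /= ->.
move=> [/cc ? h]; split=> // j; have [d1 c1] := h j; split.
  by move=> x Vx; apply: (partial_ext j oV ff Vx).1; exact: d1.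
by apply: IH c1 => x Vx; exact: (partial_ext j oV ff Vx).2.
Qed.

Lemma open_r2c U : open U -> open (r2c @^-1` U).
Proof. by rewrite -c2r_image; exact: open_c2r. Qed.

Lemma ccont_Re g x : ccont g (r2c x) ->
  {for x, continuous (fun y => complex.Re (g (r2c y)))}.
Proof.
move=> gc P /nbhs_ballP[e /= e0 hP]; have /nearC[s s0 hs] := gc _ e0.
apply/nbhs_r2c; exists s => // y /hs h; apply: hP.
rewrite -ball_normE /ball_ /= -ReB; apply: le_lt_trans h.
by rewrite cabsB; exact: le_Re_cabs.
Qed.

(** The partial derivatives of [Re g] are [Re g'] and [Re (g' * i)], again
    real parts of holomorphic functions. *)
Lemma hol_Ck k U g : open U -> hol k U g ->
  Ck k (r2c @^-1` U) (fun x => complex.Re (g (r2c x))).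
Proof.
move=> oU; elim: k g => [|k IH] g hg.
  by split=> // x Ux; apply: ccont_Re; exact: hol_cont hg Ux.
have cg x : (r2c @^-1` U) x -> {for x, continuous (fun x => complex.Re (g (r2c x)))}.
  by move=> Ux; apply: ccont_Re; exact: hol_cont hg Ux.
move: hg => [g' gg' hg']; split=> // j; split.
  by move=> x Ux; have [] := is_derive_Re (delta_mx 0 j) (gg' _ Ux).
apply: (@Ck_ext _ k (fun x => complex.Re (g' (r2c x) * dirc j))).
- exact: open_r2c.
- by move=> x Ux; rewrite (partial_Re j (gg' _ Ux)).
- apply: (IH (fun z => g' z * dirc j)).
  by apply: holM => //; exact: hol_cst.
Qed.

Definition cmap g : E -> E := fun x => c2r (g (r2c x)).

Lemma component_cmap g (i : 'I_2) :
  component (cmap g) i = fun x => complex.Re ((dirc i)^*%C * g (r2c x)).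
Proof.
apply/funext => x; rewrite /component /cmap !mxE /dirc.
case: i => [[|[|//]] p] /=; first by rewrite ReM /=; ring.
by rewrite ReM /=; ring.
Qed.

Lemma smooth_cmap U g : open U -> (forall k, hol k U g) ->
  smooth_on (r2c @^-1` U) (cmap g).
Proof.
move=> oU hg i k; rewrite component_cmap.
apply: (@hol_Ck k U (fun z => (dirc i)^*%C * g z)) => //.
by apply: holM => //; exact: hol_cst.
Qed.

Lemma partial_cmap i j g x d : sderiv g (r2c x) d ->
  partial j (component (cmap g) i) x = complex.Re ((dirc i)^*%C * d * dirc j).
Proof.
move=> gd; rewrite component_cmap; apply: (@partial_Re j (fun z => (dirc i)^*%C * g z)).
have := sderivM (sderiv_cst (dirc i)^*%C (r2c x)) gd.
by rewrite mul0r add0r.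
Qed.

(** The components are harmonic: the two second derivatives carry the factors
    [1] and [i ^ 2]. *)
Lemma laplacian_cmap U i g g1 g2 x : open U ->
  (forall z, U z -> sderiv g z (g1 z)) -> (forall z, U z -> sderiv g1 z (g2 z)) ->
  U (r2c x) -> laplacian (component (cmap g) i) x = 0.
Proof.
move=> oU h1 h2 Ux; rewrite /laplacian.
have H j : partial j (partial j (component (cmap g) i)) x =
    complex.Re ((dirc i)^*%C * dirc j * g2 (r2c x) * dirc j).
  have oV := open_r2c oU.
  have ff y : (r2c @^-1` U) y -> partial j (component (cmap g) i) y =
      complex.Re (((dirc i)^*%C * dirc j) * g1 (r2c y)).
    by move=> Uy; rewrite (partial_cmap i j (h1 _ Uy)); congr complex.Re; ring.
  rewrite (partial_ext j oV ff Ux).2.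
  apply: (@partial_Re j (fun z => (dirc i)^*%C * dirc j * g1 z)).
  have := sderivM (sderiv_cst ((dirc i)^*%C * dirc j) (r2c x)) (h2 _ Ux).
  by rewrite mul0r add0r.
rewrite big_ord_recl big_ord1 !H -ReD; set c := (dirc i)^*%C.
have ii : 'i%C * 'i%C = -1 :> C by rewrite -expr2 sqr_i.
have -> : dirc ord0 = 1 by [].
have -> : dirc (lift ord0 ord0) = 'i%C by [].
rewrite (_ : _ + _ = c * g2 (r2c x) * (1 + 'i%C * 'i%C)); last by ring.
by rewrite ii subrr mulr0.
Qed.

End Plane.

Arguments r2c {R} x.

(** * Boundary charts: coordinates and normals *)

Section LocalChart.
Variable R : realType.
Local Notation C := R[i].
Local Notation E := 'rV[R]_2.
Local Notation c2r := (@R2_of_complex R).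
Implicit Types (z w p q d : C) (e r K : R) (x y v : E) (O U V : set C).

(** Holomorphic coordinates at [p] in which [O] is the right half-plane. The
    ball of the atlas is chosen inside [U] only when the size of the
    derivatives is known. *)
Definition dom_chart O p := exists (U V : set C) (F phi phi' : C -> C),
  [/\ [/\ open U, open V & U p],
      (forall z, U z -> V (phi z) /\ F (phi z) = z),
      (forall w, V w -> U (F w) /\ phi (F w) = w),
      (forall k, hol k V F) /\ (forall k, hol k U phi') &
      forall z, U z -> [/\ sderiv phi z (phi' z), phi' z != 0,
        O z <-> 0 < complex.Re (phi z) & boundary O z <-> complex.Re (phi z) = 0]].

Lemma eball_r2c p r : eball (c2r p) r = r2c @^-1` [set z | cabs (z - p) < r].
Proof.
by apply/funext => x; rewrite /eball /preimage /= enorm_r2c r2cB c2rK.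
Qed.

Lemma boundary_half_space (x : E) : x 0 0 = 0 -> boundary (@half_space R 1) x.
Proof.
move=> x0; split.
  move=> P /nbhs_r2c[e e0 h]; exists (x + c2r (e / 2)%:C%C); split.
    by rewrite /half_space /= !mxE /= x0 add0r divr_gt0.
  apply: h; rewrite r2cD c2rK addrAC subrr add0r cabs_real gtr0_norm ?divr_gt0//.
  by rewrite ltr_pdivrMr// ltr_pMr// ltr1n.
by move=> /interior_subset; rewrite /half_space /= x0 ltxx.
Qed.

Lemma cabs_dirc (j : 'I_2) : cabs (dirc R j) = 1.
Proof.
rewrite /dirc; case: ifP => _; first exact: cabs1.
by rewrite /cabs /= expr0n /= add0r expr1n sqrtr1.
Qed.

Section FixedChart.
Variables (O U V : set C) (F phi phi' : C -> C).
Hypotheses (oU : open U) (oV : open V).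
Hypothesis UV : forall z, U z -> V (phi z) /\ F (phi z) = z.
Hypothesis VU : forall w, V w -> U (F w) /\ phi (F w) = w.
Hypothesis holF : forall k, hol k V F.
Hypothesis holphi' : forall k, hol k U phi'.
Hypothesis phid : forall z, U z -> sderiv phi z (phi' z).
Hypothesis phi0 : forall z, U z -> phi' z != 0.
Hypothesis OU : forall z, U z -> (O z <-> 0 < complex.Re (phi z)).
Hypothesis bOU : forall z, U z -> (boundary O z <-> complex.Re (phi z) = 0).

Lemma hol_phi k : hol k U phi.
Proof. by apply: hol_pred; exists phi'. Qed.

Lemma chart_coordinate p r : 0 < r -> (forall z, cabs (z - p) < r -> U z) ->
  coordinate_mapping (c2r @` O) (c2r p) r (cmap phi).
Proof.
move=> r0 rU; set B := [set z | cabs (z - p) < r].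
have oB : open B by exact: open_cball.
(* The image of the ball under [phi], written as a preimage. *)
pose W := V `&` F @^-1` B.
have imB : cmap phi @` (r2c @^-1` B) = r2c @^-1` W.
  apply/seteqP; split=> [_ [x Bx <-]|y [Vy By]].
    by have [h1 h2] := UV (rU _ Bx); rewrite /W /preimage /cmap /= c2rK; split=> //=; rewrite h2.
  exists (cmap F y); first by rewrite /preimage /cmap /= c2rK.
  by rewrite /cmap c2rK (VU Vy).2 r2cK.
have oW : open W.
  rewrite openE => w [Vw Bw].
  have h1 : nbhs w V by exact: open_nbhs_nbhs.
  have /nbhsC[e e0 he] : nbhs (F w) B by exact: open_nbhs_nbhs.
  have h2 := hol_cont (holF 0) Vw e0.
  by apply: filterS2 h1 h2 => z Vz /he.
split=> //; rewrite ?eball_r2c -/B.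
- apply: smooth_cmap => // k; apply: (hol_sub _ (hol_phi k)); exact: rU.
- by rewrite imB; exact: open_r2c.
- exists (cmap F).
    rewrite imB; apply: smooth_cmap => // k; apply: (hol_sub _ (holF k)).
    by move=> z [].
  by move=> y By; rewrite /cmap c2rK (UV (rU _ By)).2 r2cK.
- split=> _ [x [Bx Ox] <-]; rewrite /half_space /=.
    move: Ox; rewrite c2r_image => Ox; rewrite /cmap mxE /=.
    exact: (OU (rU _ Bx)).1.
  move: Ox; rewrite boundary_c2r c2r_image => Ox; apply: boundary_half_space.
  by rewrite /cmap mxE /=; exact: (bOU (rU _ Bx)).1.
Qed.

(** [Re (phi (c t))] vanishes along a curve [c] in the boundary, so its
    derivative [Re (phi' q * v)] vanishes. As only the derivative of [c] at 0
    is given, the chain rule is replaced by the strict estimate for [phi] at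
    [q] along one small increment of [c]. *)
Lemma tangent_orthogonal q v : U q -> tangent_vector (boundary (c2r @` O)) (c2r q) v ->
  complex.Re (phi' q * r2c v) = 0.
Proof.
move=> Uq [c [c0 cO [cd cv]]].
have bq : complex.Re (phi q) = 0.
  have := nbhs_singleton cO; rewrite c0 boundary_c2r c2r_image /preimage /= c2rK.
  exact: (bOU Uq).1.
have lim : (fun h : R => h^-1 *: ((c \o shift 0) (h *: (1 : R)) - c 0)) @ 0^' --> v.
  by rewrite -cv; move: cd; rewrite /derivable /derive.
pose M := cabs (phi' q) + cabs (r2c v) + 1.
have [m1 m2] := (cabs_ge0 (phi' q), cabs_ge0 (r2c v)).
have M0 : 0 < M by rewrite /M; lra.
suff H e : 0 < e -> e <= 1 -> `|complex.Re (phi' q * r2c v)| <= e * M.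
  apply/eqP; rewrite -normr_le0; apply/ler_addgt0Pr => e e0; rewrite add0r.
  pose e1 := Num.min 1 (e / M); have e10 : 0 < e1 by rewrite lt_min ltr01 divr_gt0.
  apply: le_trans (H e1 e10 _) _; first by rewrite ge_min lexx.
  apply: le_trans (ler_wpM2r (ltW M0) (_ : e1 <= e / M)) _.
    by rewrite ge_min lexx orbT.
  by rewrite divfK// lt0r_neq0.
move=> e0 e1.
have [r r0 hr] := phid Uq e0.
have cc : {for 0, continuous c}.
  have /derivable1_diffP/differentiable_continuous := cd.
  exact.
have nU : \forall h \near 0, cabs (r2c (c h) - q) < r.
  apply: (cc [set y | cabs (r2c y - q) < r]); rewrite c0.
  by apply/nbhs_r2c; exists r => // y; rewrite c2rK.
have nU2 : \forall h \near 0, U (r2c (c h)).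
  apply: (cc [set y | U (r2c y)]); rewrite c0.
  apply/(nbhs_r2cE _ U); rewrite c2rK; exact: open_nbhs_nbhs.
have nv : \forall h \near 0^', cabs (r2c (h^-1 *: (c h - c 0)) - r2c v) < e.
  have : nbhs v [set y | cabs (r2c y - r2c v) < e] by apply/nbhs_r2c; exists e.
  move=> /lim hl; apply: (@filterS _ (0 : R)^' _ _ _ _ hl) => h /=.
  by rewrite /shift /= addr0 [h *: 1]mulr1.
have /filter_ex : \forall h \near (0 : R)^', [/\ h != 0, cabs (r2c (c h) - q) < r,
    boundary (c2r @` O) (c h), U (r2c (c h)) &
    cabs (r2c (h^-1 *: (c h - c 0)) - r2c v) < e].
  near=> h; split.
  - by near: h; exact: nbhs_dnbhs_neq.
  - by near: h; exact: nbhs_dnbhs.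
  - by near: h; exact: nbhs_dnbhs.
  - by near: h; exact: nbhs_dnbhs.
  - by near: h.
move=> [h [h0 hq hO hU hv]].
have bh : complex.Re (phi (r2c (c h))) = 0.
  by move: hO; rewrite boundary_c2r c2r_image; exact: (bOU hU).1.
have := hr _ q hq; rewrite subrr cabs0 => /(_ r0) H.
have H1 : `|complex.Re (phi' q * (r2c (c h) - q))| <= e * cabs (r2c (c h) - q).
  apply: le_trans H; apply: le_trans (le_Re_cabs _).
  by rewrite 2!ReB bh bq subrr sub0r normrN.
have qE : r2c (h^-1 *: (c h - c 0)) = (h^-1)%:C%C * (r2c (c h) - q).
  by rewrite r2cZ r2cB c0 c2rK.
set Q := r2c (h^-1 *: _) in hv qE.
have H2 : `|complex.Re (phi' q * Q)| <= e * cabs Q.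
  have -> : phi' q * Q = (h^-1)%:C%C * (phi' q * (r2c (c h) - q)) by rewrite qE; ring.
  by rewrite ReZ qE cabsM cabs_real mulrCA normrM ler_wpM2l.
have -> : phi' q * r2c v = phi' q * Q - phi' q * (Q - r2c v) by ring.
rewrite ReB; apply: le_trans (ler_normB _ _) _.
have H3 : `|complex.Re (phi' q * (Q - r2c v))| <= cabs (phi' q) * e.
  apply: le_trans (le_Re_cabs _) _; rewrite cabsM; apply: ler_wpM2l => //; exact: ltW.
have H4 : e * cabs Q <= e * (cabs (r2c v) + 1).
  apply: ler_wpM2l; first exact: ltW.
  have := cabsBD Q (r2c v); lra.
rewrite /M; lra.
Unshelve. all: by end_near. Qed.

Lemma r2c_grad (i : 'I_2) q : U q ->
  r2c (grad (component (cmap phi) i) (c2r q)) = dirc R i * (phi' q)^*%C.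
Proof.
move=> Uq; have qd : sderiv phi (r2c (c2r q)) (phi' q) by rewrite c2rK; exact: phid.
have e0 : dirc R 0 = 1 by [].
have e1 : dirc R 1 = 'i%C by [].
apply: complex_eq; rewrite /= !mxE (partial_cmap i _ qd) ?e0 ?e1.
  by move: (dirc R i) (phi' q) => [a b] [c d] /=; ring.
by move: (dirc R i) (phi' q) => [a b] [c d] /=; ring.
Qed.

(** The normal is the conjugate of [phi' q] divided by its modulus, the
    direction that multiplication by [phi' q] turns into the positive real
    axis. *)
Lemma chart_normal q : U q -> boundary O q ->
  maps_normal_to_e1 (c2r @` O) (cmap phi) (c2r q).
Proof.
move=> Uq bq; have d0 := phi0 Uq; set d := phi' q in d0.
have n0 : 0 < cabs d by rewrite cabs_gt0.
pose g := (cabs d)^-1%:C%C * d^*%C.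
have cg : cabs g = 1.
  by rewrite /g cabsM cabs_conj cabs_real ger0_norm ?invr_ge0 ?cabs_ge0// mulVf ?lt0r_neq0.
have dg : d * g = (cabs d)%:C%C.
  rewrite /g mulrCA conjc_mul_cabs -rmorphM /=; congr (_%:C%C); field.
  exact: lt0r_neq0.
exists (c2r g).
  split.
  - by rewrite enorm_r2c c2rK.
  - move=> v /(tangent_orthogonal Uq) h; rewrite edotE c2rK.
    rewrite (_ : _ * r2c v = ((cabs d)^-1)%:C%C * (d * r2c v)); last first.
      by rewrite /g rmorphM /= conjcK oppr0 mulrA.
    by rewrite ReZ h mulr0.
  - have /nbhsC[r1 r10 hU] : nbhs q U by exact: open_nbhs_nbhs.
    have d2 : 0 < cabs d / 2 by rewrite divr_gt0.
    have [r2 r20 hr] := phid Uq d2.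
    near=> t.
    have t0 : 0 < t by near: t; exact: nbhs_right_gt.
    have t1 : t < r1 by near: t; exact: nbhs_right_lt.
    have t2 : t < r2 by near: t; exact: nbhs_right_lt.
    have ct : cabs (t%:C%C * g) = t by rewrite cabsM cg mulr1 cabs_real gtr0_norm.
    rewrite c2r_image /preimage /= r2cD r2cZ !c2rK; set z := q + _.
    have zq : z - q = t%:C%C * g by rewrite /z addrAC subrr add0r.
    have Uz : U z by apply: hU; rewrite zq ct.
    apply/(OU Uz).
    have := hr z q; rewrite zq ct subrr cabs0 => /(_ t2 r20) H.
    have dt : phi' q * (t%:C%C * g) = (t * cabs d)%:C%C.
      by rewrite mulrCA -/d dg -rmorphM.
    have bq0 := (bOU Uq).1 bq.
    have := le_trans (le_Re_cabs _) H; rewrite dt 2!ReB bq0 subr0 /=.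
    rewrite ler_norml => /andP[H1 _].
    have : 0 < t * cabs d by rewrite mulr_gt0.
    lra.
move=> i /=; rewrite edotE enorm_r2c (r2c_grad i Uq) c2rK -/d.
rewrite cabsM cabs_dirc cabs_conj mul1r rmorphM /= conjcK -mulrA dg.
rewrite ReM /= mulr0 subr0 /dirc; case: i => [[|[|//]] p] /=; ring.
Unshelve. all: by end_near. Qed.

End FixedChart.
End LocalChart.

(** * Uniform bounds and the finite cover *)

Section Assembly.
Variable R : realType.
Local Notation C := R[i].
Local Notation E := 'rV[R]_2.
Local Notation c2r := (@R2_of_complex R).
Implicit Types (z w p q d : C) (e r K : R) (x y v : E) (O U V : set C).

Lemma enormB x y : enorm (x - y) = cabs (r2c x - r2c y).
Proof. by rewrite enorm_r2c r2cB. Qed.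

Lemma enorm_sqr v : enorm v ^+ 2 = edot v v.
Proof. by rewrite enorm_r2c cabs_sqr edotE ReM /=; ring. Qed.

(** A conformal Jacobian is [cabs d] times a rotation. *)
Lemma Jacobian_cmap (phi : C -> C) x d : sderiv phi (r2c x) d ->
  Jacobian (cmap phi) x *m (Jacobian (cmap phi) x)^T = (cabs d ^+ 2)%:M.
Proof.
move=> pd; apply/matrixP => i j; rewrite !mxE big_ord_recl big_ord1 !mxE.
rewrite !(partial_cmap _ _ pd) cabs_sqr.
have -> : dirc R ord0 = 1 by [].
have -> : dirc R (lift ord0 ord0) = 'i%C by [].
case: d {pd} => a b; rewrite /dirc.
by case: i => [[|[|//]] ?]; case: j => [[|[|//]] ?] /=; ring.
Qed.

(** Near [p], strict differentiability of [phi] and of [phi'] gives the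
    Lipschitz bounds, continuity of [phi'] keeps its modulus between half and
    twice its value at [p], and the Laplacians vanish. Any [K'] above [K] is
    allowed so that one constant can serve finitely many charts. *)
Lemma chart_bounds (U : set C) (phi phi' : C -> C) p : open U ->
  (forall k, hol k U phi') -> (forall z, U z -> sderiv phi z (phi' z)) ->
  phi' p != 0 -> U p ->
  exists r K, [/\ 0 < r, 0 < K, (forall z, cabs (z - p) < r -> U z) &
    forall K', K <= K' -> uniform_bounds K' K' K' K' (eball (c2r p) r) (cmap phi)].
Proof.
move=> oU holphi' phid d0 Up; set d := phi' p in d0.
have n0 : 0 < cabs d by rewrite cabs_gt0.
have [phi2 phi'd _] := holphi' 1%N.
set d2 := phi2 p; have m0 : 0 <= cabs d2 := cabs_ge0 _.
have nU : nbhs p U by exact: open_nbhs_nbhs.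
have h2 : 0 < cabs d / 2 by rewrite divr_gt0.
have [r r0 hr] := near2I (near2I (near2_near nU) (near2_near (sderiv_cont (phi'd _ Up) h2)))
  (near2I (near2I (sderiv_low (phid _ Up) d0) (sderiv_lip (phid _ Up)))
    (sderiv_lip (phi'd _ Up))).
have rU z : cabs (z - p) < r -> U z by move=> zr; have [[[? _] _] _] := hr z z zr zr.
have i0 : 0 < 2 / cabs d by rewrite divr_gt0.
have i1 : 0 < 4 / cabs d ^+ 2 by rewrite divr_gt0// exprn_gt0.
have i2 : 0 < cabs d ^+ 2 by rewrite exprn_gt0.
(* Each summand settles one of the required inequalities. *)
exists r, (2 / cabs d + (2 * cabs d + 1) + (cabs d2 + 1) + 4 / cabs d ^+ 2 +
  4 * cabs d ^+ 2); split=> //; first by lra.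
move=> K' hK; have K0 : 0 < K' by lra.
have hb z : cabs (z - p) < r -> cabs d / 2 <= cabs (phi' z) <= 2 * cabs d.
  move=> zr; have [[_ [h _]] _] := hr z z zr zr.
  have := cabsBD (phi' z) d; have := cabsBD d (phi' z).
  by rewrite (cabsB d) -/d in h * => ? ?; apply/andP; split; lra.
have part i j x : U (r2c x) -> partial j (component (cmap phi) i) x =
    complex.Re ((dirc R i)^*%C * phi' (r2c x) * dirc R j).
  by move=> Ux; apply: partial_cmap; exact: phid.
have lap i x : U (r2c x) -> laplacian (component (cmap phi) i) x = 0.
  by move=> Ux; apply: (@laplacian_cmap R U i phi phi' phi2).
have twist i j z : `|complex.Re ((dirc R i)^*%C * z * dirc R j)| <= cabs z.
  apply: le_trans (le_Re_cabs _) _.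
  by rewrite !cabsM cabs_conj !cabs_dirc mul1r mulr1.
split.
- move=> x y; rewrite !eball_r2c /preimage /= => xr yr.
  have [_ [[h3 h4] _]] := hr _ _ xr yr; rewrite !enormB /cmap !c2rK.
  have c0 := cabs_ge0 (r2c x - r2c y); apply/andP; split.
    rewrite mulrC; apply: le_trans h3; apply: ler_wpM2r => //.
    rewrite -[leRHS]invrK lef_pV2 ?posrE// ?invr_gt0//.
    by rewrite invf_div; lra.
  by apply: le_trans h4 _; apply: ler_wpM2r => //; lra.
- move=> i j; split=> x; rewrite eball_r2c /preimage /= => xr.
    rewrite part; last exact: rU.
    by apply: le_trans (twist _ _ _) _; have /andP[_ h] := hb _ xr; lra.
  by rewrite lap ?normr0; [exact: ltW|exact: rU].
- move=> i j; split=> x y; rewrite eball_r2c /preimage /= => xr yr.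
    rewrite !part; [|exact: rU|exact: rU].
    have [_ [_ h5]] := hr _ _ xr yr.
    rewrite -ReB -mulrBl -mulrBr enormB; apply: le_trans (twist _ _ _) _.
    apply: le_trans h5 _; apply: ler_wpM2r; first exact: cabs_ge0.
    lra.
  rewrite !lap ?subrr ?normr0; [|exact: rU|exact: rU].
  by rewrite mulr_ge0 ?enormB ?cabs_ge0// ltW.
- move=> x; rewrite eball_r2c /preimage /= => xr v.
  rewrite (Jacobian_cmap (phid _ (rU _ xr))) mul_mx_scalar -scalemxAl mxE.
  have -> : (v *m v^T) 0 0 = enorm v ^+ 2.
    by rewrite enorm_sqr mxE; apply: eq_bigr => i _; rewrite mxE.
  have /andP[b1 b2] := hb _ xr.
  have v0 : 0 <= enorm v ^+ 2 by rewrite exprn_ge0// sqrtr_ge0.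
  have c1 : cabs d ^+ 2 / 4 <= cabs (phi' (r2c x)) ^+ 2.
    have -> : cabs d ^+ 2 / 4 = (cabs d / 2) ^+ 2 by field.
    by rewrite lerXn2r// nnegrE ?cabs_ge0 ?(ltW h2).
  have c2 : cabs (phi' (r2c x)) ^+ 2 <= 4 * cabs d ^+ 2.
    have -> : 4 * cabs d ^+ 2 = (2 * cabs d) ^+ 2 by ring.
    by rewrite lerXn2r// nnegrE ?cabs_ge0// mulr_ge0 ?cabs_ge0.
  apply/andP; split; apply: ler_wpM2r => //; last by lra.
  apply: le_trans c1; rewrite -[leRHS]invrK lef_pV2 ?posrE ?invr_gt0//; last first.
    by rewrite divr_gt0.
  by rewrite invf_div; lra.
Qed.

Lemma chart_data O p : dom_chart O p -> exists (rPK : R * (E -> E) * R),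
  let: (r, Phi, K) := rPK in
  [/\ coordinate_mapping (c2r @` O) (c2r p) r Phi, 0 < K,
    (forall x, eball (c2r p) r x -> boundary (c2r @` O) x ->
       maps_normal_to_e1 (c2r @` O) Phi x) &
    forall K', K <= K' -> uniform_bounds K' K' K' K' (eball (c2r p) r) Phi].
Proof.
move=> [U [V [F [phi [phi' [[oU oV Up] UV VU [hF hphi'] H]]]]]].
have phid z : U z -> sderiv phi z (phi' z) by case/H.
have phi0 z : U z -> phi' z != 0 by case/H.
have OU z : U z -> (O z <-> 0 < complex.Re (phi z)) by case/H.
have bOU z : U z -> (boundary O z <-> complex.Re (phi z) = 0) by case/H.
have [r [K [r0 K0 rU hK]]] := chart_bounds oU hphi' phid (phi0 _ Up) Up.
exists (r, cmap phi, K); split=> //.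
  exact: (chart_coordinate oV UV VU hF hphi' phid OU bOU r0 rU).
move=> x; rewrite eball_r2c /preimage /= => xr bx.
rewrite -[x]r2cK; apply: (chart_normal oU phid phi0 OU bOU); first exact: rU.
by move: bx; rewrite boundary_c2r c2r_image.
Qed.

(** Finitely many of the balls cover the compact boundary, and the sum of
    their constants is above each of them. The finite list of centres is
    turned into a sequence by repeating its first element at the end. *)
Lemma SULD_of_charts O : open O -> connected O -> boundary O !=set0 ->
  compact (c2r @` boundary O) -> (forall p, boundary O p -> dom_chart O p) ->
  SULD (c2r @` O).
Proof.
move=> oO cO [p0 bp0] kO charts.
have : forall x : E, exists rPK : R * (E -> E) * R, let: (r, Phi, K) := rPK in
    0 < K /\ (boundary (c2r @` O) x -> [/\ coordinate_mapping (c2r @` O) x r Phi,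
    (forall y, eball x r y -> boundary (c2r @` O) y ->
       maps_normal_to_e1 (c2r @` O) Phi y) &
    forall K', K <= K' -> uniform_bounds K' K' K' K' (eball x r) Phi]).
  move=> x; have [bx|nbx] := pselect (boundary (c2r @` O) x); last first.
    by exists (1, id, 1); split.
  have : boundary O (r2c x) by move: bx; rewrite boundary_c2r c2r_image.
  move=> /charts/chart_data[[[r Phi] K]]; rewrite r2cK => -[? ? ? ?].
  by exists (r, Phi, K); split.
move=> /choice[D hD].
pose rad x := (D x).1.1; pose Phi x := (D x).1.2; pose K x := (D x).2.
have K0 x : 0 < K x by have := hD x; rewrite /K; case: (D x) => [[? ?] ?] [].
have hC x : boundary (c2r @` O) x -> [/\ coordinate_mapping (c2r @` O) x (rad x) (Phi x),
    (forall y, eball x (rad x) y -> boundary (c2r @` O) y ->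
       maps_normal_to_e1 (c2r @` O) (Phi x) y) &
    forall K', K x <= K' -> uniform_bounds K' K' K' K' (eball x (rad x)) (Phi x)].
  by have := hD x; rewrite /rad /Phi /K; case: (D x) => [[? ?] ?] [].
have atlas : smooth_atlas (c2r @` O) rad Phi by move=> x /hC[].
have x0 : boundary (c2r @` O) (c2r p0) by rewrite boundary_c2r; exists p0.
split.
  by split; [exact: open_c2r|exact: connected_c2r|exists rad, Phi].
exists rad, Phi; split=> //.
have openball x r : open (eball x r).
  by rewrite -[x]r2cK eball_r2c; apply: open_r2c; exact: open_cball.
have := kO; rewrite compact_cover => /(_ _ (boundary (c2r @` O)) (fun x => eball x (rad x))).
case.
- by move=> x _; exact: openball.
- move=> x; rewrite -boundary_c2r => bx; exists x => //.
  by have [[r0 _ _ _ _] _ _] := hC _ bx; rewrite /eball /= subrr enorm_r2c /r2c !mxE cabs0.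
move=> S Sb Scov; pose l := c2r p0 :: finmap.enum_fset S.
have lb x : x \in l -> boundary (c2r @` O) x.
  rewrite inE => /orP[/eqP->//|xS]; exact/set_mem/Sb.
(* Indices start at 1; the default value of [nth] pads the list. *)
pose c k := nth (c2r p0) l k.-1.
have cb k : boundary (c2r @` O) (c k).
  rewrite /c; have [kl|kl] := ltnP k.-1 (size l); first exact/lb/mem_nth.
  by rewrite nth_default.
pose KK := \sum_(x <- l) K x.
have KK0 : 0 < KK.
  by rewrite /KK big_cons ltr_pwDl// sumr_ge0// => x _; exact: ltW.
have Kl x : x \in l -> K x <= KK.
  rewrite /KK; elim: l {lb c cb KK KK0} => // a l IH; rewrite inE big_cons.
  move=> /orP[/eqP->|/IH h]; first by rewrite lerDl sumr_ge0// => y _; exact: ltW.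
  by apply: le_trans h _; rewrite lerDr ltW.
have cl k : c k \in l.
  rewrite /c; have [kl|kl] := ltnP k.-1 (size l); first exact/mem_nth.
  by rewrite nth_default// mem_head.
exists (fun k => if k is k'.+1 then eball (c k) (rad (c k)) else c2r @` O), c; split.
- by split; [exact: open_c2r|].
- by case=> // k _.
- move=> x cx; have [Ox|nOx] := pselect ((c2r @` O) x); first by exists 0%N.
  have : (c2r @` boundary O) x.
    by rewrite -boundary_c2r; split=> // /interior_subset.
  move=> /Scov[y /= yS yx]; exists (index y l).+1 => //=.
  by rewrite /c /= nth_index// inE yS orbT.
- by case=> // k _ x Ux bx; have [_ h _] := hC _ (cb k.+1); exact: h.
- exists KK, KK, KK, KK; split=> //; case=> // k _.
  by have [_ _ h] := hC _ (cb k.+1); apply: h; exact: Kl.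
Qed.

End Assembly.

(** * Charts along an analytic curve *)

Section ChartFromSide.
Variable R : realType.
Local Notation C := R[i].
Implicit Types (z w p q d : C) (e r s sigma : R) (O U V N : set C) (f : C -> C).

(** The inverse of the Cayley transform that maps [w] to [sigma * (w0 - w) /
    (w0 + w)]: 0 goes to [w0], the imaginary axis into the unit circle, and
    the right half-plane to the inside of the circle if [sigma = 1], to its
    outside if [sigma = -1]. *)
Definition cayley w0 sigma z : C :=
  w0 * ((1 - sigma%:C%C * z) * (1 + sigma%:C%C * z)^-1).

Lemma cayley_den sigma z : sigma ^+ 2 = 1 -> cabs z < 1 -> 1 + sigma%:C%C * z != 0.
Proof.
move=> s1 z1; apply/eqP => h; have : sigma%:C%C * z = - 1.
  by apply/eqP; rewrite -subr_eq0 opprK addrC h.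
move/(congr1 (@cabs R)); rewrite cabsM cabsN cabs1 cabs_sign// mul1r => h1.
by move: z1; rewrite h1 ltxx.
Qed.

(** The squared moduli of [1 + sigma * z] and [1 - sigma * z] differ by [4 *
    sigma * Re z]. *)
Lemma cayley_side w0 sigma z : cabs w0 = 1 -> sigma ^+ 2 = 1 -> cabs z < 1 ->
  (0 < sigma * (1 - cabs (cayley w0 sigma z)) <-> 0 < complex.Re z) /\
  (cabs (cayley w0 sigma z) = 1 <-> complex.Re z = 0).
Proof.
move=> w1 s1 z1; have den := cayley_den s1 z1.
rewrite /cayley !cabsM w1 mul1r cabsV.
set D := 1 + sigma%:C%C * z in den *; set Nn := 1 - sigma%:C%C * z.
have D0 : 0 < cabs D by rewrite cabs_gt0.
have key : cabs D ^+ 2 - cabs Nn ^+ 2 = 4 * sigma * complex.Re z.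
  rewrite !cabs_sqr /D /Nn; case: (z) => a b /=; ring.
have N0 := cabs_ge0 Nn.
set m := cabs Nn / cabs D.
have m0 : 0 <= m by rewrite divr_ge0// ltW.
have mD : cabs Nn = m * cabs D by rewrite /m divfK// lt0r_neq0.
have P0 : 0 < (1 + m) * cabs D ^+ 2 by rewrite mulr_gt0 ?exprn_gt0//; lra.
have key2 : sigma * (1 - m) * ((1 + m) * cabs D ^+ 2) = 4 * complex.Re z.
  have -> : 4 * complex.Re z = sigma * (4 * sigma * complex.Re z).
    by rewrite -[LHS]mul1r -s1; ring.
  by rewrite -key mD; ring.
split; split => h.
- have : 0 < sigma * (1 - m) * ((1 + m) * cabs D ^+ 2) by rewrite mulr_gt0.
  rewrite key2; lra.
- by rewrite -(pmulr_lgt0 _ P0) key2 mulr_gt0.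
- by move: key2; rewrite h subrr mulr0 mul0r; lra.
- move/eqP: key2; rewrite h mulr0 mulf_eq0 (gt_eqF P0) orbF mulf_eq0.
  have -> : (sigma == 0) = false.
    by apply/negbTE; move: (oner_neq0 R); rewrite -s1 expf_eq0.
  by rewrite /= subr_eq0 => /eqP/esym.
Qed.

Lemma cayley_inj w0 sigma x y : cabs w0 = 1 -> sigma ^+ 2 = 1 ->
  cabs x < 1 -> cabs y < 1 -> cayley w0 sigma x = cayley w0 sigma y -> x = y.
Proof.
move=> w1 s1 x1 y1; have dx := cayley_den s1 x1; have dy := cayley_den s1 y1.
have w0n : w0 != 0 by rewrite -cabs_gt0 w1.
move=> /(mulfI w0n) /eqP; rewrite eqr_div// => /eqP h.
have sc : sigma%:C%C != 0 :> C by rewrite -cabs_gt0 cabs_sign.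
have : 2 * sigma%:C%C * x = 2 * sigma%:C%C * y.
  apply/eqP; rewrite -subr_eq0; apply/eqP.
  transitivity (((1 - sigma%:C%C * y) * (1 + sigma%:C%C * x)) -
    ((1 - sigma%:C%C * x) * (1 + sigma%:C%C * y))); first by ring.
  by rewrite h subrr.
by apply: mulfI; rewrite mulf_neq0// pnatr_eq0.
Qed.

Lemma hol_cayley w0 sigma k : sigma ^+ 2 = 1 ->
  hol k [set z : C | cabs z < 1] (cayley w0 sigma).
Proof.
move=> s1; apply: holM; first exact: hol_cst.
have hlin c : hol k [set z : C | cabs z < 1] (fun z => 1 + c * z).
  by apply: holD; [exact: hol_cst|apply: holM; [exact: hol_cst|exact: hol_id]].
apply: holM.
  by have := hlin (- sigma%:C%C); congr hol; apply/funext => z; rewrite mulNr.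
apply: (@hol_comp R k _ [set z : C | z != 0] (fun z => z^-1) (fun z => 1 + sigma%:C%C * z)).
- exact: hol_inv.
- exact: hlin.
- by move=> z; exact: cayley_den.
Qed.

Lemma sderiv_cayley0 w0 sigma : sderiv (cayley w0 sigma) 0 (- 2 * sigma%:C%C * w0).
Proof.
have lin c : sderiv (fun z => 1 + c * z) 0 c.
  have := sderivD (sderiv_cst (1 : C) 0) (sderivM (sderiv_cst c 0) (@sderiv_id R 0)).
  by rewrite mul0r !add0r mulr1.
have d1 : sderiv (fun z : C => 1 - sigma%:C%C * z) 0 (- sigma%:C%C).
  by have := lin (- sigma%:C%C); congr sderiv; apply/funext => z; rewrite mulNr.
have one : 1 + sigma%:C%C * 0 = 1 :> C by rewrite mulr0 addr0.
have d2 : sderiv (fun z : C => (1 + sigma%:C%C * z)^-1) 0 (- sigma%:C%C).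
  have := @sderiv_comp R (fun z => z^-1) (fun z => 1 + sigma%:C%C * z) 0
    (- (1^-1 * 1^-1)) sigma%:C%C.
  rewrite one invr1 mulr1 mulN1r; apply; last exact: lin.
  by have := sderivV (oner_neq0 C); rewrite invr1 mulr1.
have := sderivM (sderiv_cst w0 0) (sderivM d1 d2).
rewrite mul0r add0r one invr1 mulr0 subr0 mulr1 mul1r.
by congr sderiv; ring.
Qed.

(** The sign is 1 if [O] is the image of the inner collar of the circle, -1 if
    it is that of the outer one. *)
Definition one_sided O f s sigma := forall w, `|cabs w - 1| < s ->
  (O (f w) <-> 0 < sigma * (1 - cabs w)).

(** The inverse chart is [f] composed with [cayley w0 sigma]: near 0 it is
    injective, its derivative does not vanish, and it maps the imaginary axis
    into the boundary and the right half-plane into [O]. The chart is its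
    inverse, hence smooth by [hol_inverse]. *)
Lemma chart_of_side O N f s sigma w0 : open N -> (forall w, N w -> analytic_at f w) ->
  (forall x y, N x -> N y -> f x = f y -> x = y) ->
  (forall w, cabs w = 1 -> N w) ->
  (forall z, boundary O z <-> exists2 w, cabs w = 1 & f w = z) ->
  0 < s -> sigma ^+ 2 = 1 -> one_sided O f s sigma -> cabs w0 = 1 ->
  dom_chart O (f w0).
Proof.
move=> oN af inj circN bO s0 s1 side w1.
have Nw0 := circN _ w1.
have [r [r0 rN hf [d d0 fd]]] := analytic_inj oN Nw0 (af _ Nw0) inj.
pose mu := cayley w0 sigma.
have mu0 : mu 0 = w0 by rewrite /mu /cayley mulr0 subr0 addr0 invr1 !mulr1.
have muc : ccont mu 0 := sderiv_cont (sderiv_cayley0 w0 sigma).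
(* [r] keeps [mu z] where [f] is a chart, [s] in the collar of [side]. *)
pose e := Num.min r s; have e0 : 0 < e by rewrite lt_min r0.
have /nearC[d1 d10 hd1] := muc _ e0.
pose dl := Num.min d1 1; have dl0 : 0 < dl by rewrite lt_min d10 ltr01.
have dl1 z : cabs z < dl -> cabs z < 1 by rewrite lt_min => /andP[].
have mur z : cabs z < dl -> cabs (mu z - w0) < e.
  by rewrite lt_min => /andP[h _]; rewrite -mu0; apply: hd1; rewrite subr0.
have murr z : cabs z < dl -> cabs (mu z - w0) < r.
  by move=> /mur; rewrite lt_min => /andP[].
have murs z : cabs z < dl -> `|cabs (mu z) - 1| < s.
  move=> /mur; rewrite lt_min -w1 => /andP[_ h]; apply: le_lt_trans h.
  exact: cabs_dist.
pose F z := f (mu z).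
pose D1 := [set z : C | cabs z < dl].
have oD1 : open D1 by exact: open_cball0.
have hF k : hol k D1 F.
  apply: (@hol_comp R k D1 [set z | cabs (z - w0) < r] f mu) => //.
  by apply: hol_sub (hol_cayley w0 k s1) => z; exact: dl1.
have [F' [FF' hF']] := hol_derivative oD1 hF.
have D10 : D1 0 by rewrite /D1 /mkset cabs0.
have F'0 : F' 0 != 0.
  have h : sderiv F 0 (d * (- 2 * sigma%:C%C * w0)).
    by apply: sderiv_comp; [rewrite -/mu mu0|exact: sderiv_cayley0].
  rewrite (sderiv_unique (FF' _ D10) h) !mulf_neq0// ?oppr_eq0 ?pnatr_eq0//.
    by rewrite -cabs_gt0 cabs_sign.
  by rewrite -cabs_gt0 w1.
have F'c : 0 < cabs (F' 0) by rewrite cabs_gt0.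
have /nearC[d2 d20 hd2] := hol_cont (hF' 0%N) D10 F'c.
pose V := [set z : C | cabs z < Num.min dl d2].
have VD1 z : V z -> D1 z by rewrite /V /D1 /= lt_min => /andP[].
have oV : open V by exact: open_cball0.
have V0 : V 0 by rewrite /V /mkset cabs0 lt_min dl0 d20.
have F'V z : V z -> F' z != 0.
  rewrite /V /= lt_min => /andP[_ h]; apply/eqP => h0.
  by have := hd2 z; rewrite subr0 h0 sub0r cabsN ltxx => /(_ h).
have injF x y : V x -> V y -> F x = F y -> x = y.
  move=> /VD1 hx /VD1 hy /inj E; apply: (cayley_inj w1 s1); [exact: dl1|exact: dl1|].
  by apply: E; apply/rN/murr.
pose U := F @` V.
have : forall z, exists w, U z -> V w /\ F w = z.
  by move=> z; have [[w Vw <-]|nU] := pselect (U z); [exists w|exists 0].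
move=> /choice[phi hphi].
have FV w : V w -> phi (F w) = w.
  by move=> Vw; have [|V1 E] := hphi (F w); [exists w|exact: injF].
have oU : open U.
  rewrite openE => _ [w Vw <-].
  have nV : nbhs w V by exact: open_nbhs_nbhs.
  have [psi [_ _ H]] := local_inverse (FF' _ (VD1 _ Vw)) (F'V _ Vw) nV.
  by apply: filterS H => z [V1 E]; exists (psi z).
have phid z : U z -> sderiv phi z (F' (phi z))^-1.
  move=> Uz; have [Vw E] := hphi _ Uz; rewrite -{1}E.
  have nV : nbhs (phi z) V by exact: open_nbhs_nbhs.
  apply: (sderiv_inverse (FF' _ (VD1 _ Vw)) (F'V _ Vw) nV injF).
  by rewrite E; apply: filterS hphi (open_nbhs_nbhs _); split.
have UV z : U z -> V (phi z) by move=> /hphi[].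
have hF'V k : hol k V F' by apply: hol_sub (hF' k) => z /VD1.
have hphi' k : hol k U phi := hol_inverse k UV phid F'V hF'V.
exists U, V, F, phi, (fun z => (F' (phi z))^-1); split.
- by split=> //; exists 0; rewrite // /F mu0.
- exact: hphi.
- by move=> w Vw; split; [exists w|exact: FV].
- split=> k; first by apply: hol_sub (hF k) => z /VD1.
  apply: (@hol_comp R k U [set z : C | z != 0] (fun z => z^-1) (fun z => F' (phi z))).
  + exact: hol_inv.
  + exact: hol_comp (hF'V k) (hphi' k) UV.
  + by move=> z /UV/F'V.
- move=> z Uz; have [Vw E] := hphi _ Uz.
  have [c1 c2] := cayley_side w1 s1 (dl1 _ (VD1 _ Vw)).
  split; [exact: phid|by rewrite invr_eq0; apply: F'V| |].
    by rewrite -c1 -/mu -{1}E /F; apply: side; exact: murs (VD1 _ Vw).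
  rewrite -c2 -/mu bO; split=> [[w cw fw]|h]; last by exists (mu (phi z)).
  suff <- : w = mu (phi z) by [].
  apply: inj; rewrite ?fw ?E//; first exact: circN.
  exact/rN/murr/VD1.
Qed.

End ChartFromSide.

(** * The two sides of the boundary curve *)

Section CurveSides.
Variable R : realType.
Local Notation C := R[i].
Local Notation c2r := (@R2_of_complex R).
Implicit Types (z w p q d : C) (e r s t sigma rho theta : R) (O U V N D : set C)
  (f : C -> C) (gam : R -> C).

Definition polar rho theta : C := (rho * cos theta +i* (rho * sin theta))%C.

Lemma cabs_polar rho theta : cabs (polar rho theta) = `|rho|.
Proof.
apply/eqP; rewrite -(@eqrXn2 _ 2) ?cabs_ge0// cabs_sqr /= !exprMn -mulrDr.
by rewrite cos2Dsin2 mulr1 real_normK ?num_real.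
Qed.

Lemma polarE z : 0 < cabs z -> exists2 theta, - pi <= theta <= pi &
  z = polar (cabs z) theta.
Proof.
move=> r0; have rn0 := lt0r_neq0 r0; set x := complex.Re z / cabs z.
have x1 : -1 <= x <= 1.
  rewrite -ler_norml normrM normfV (gtr0_norm r0) ler_pdivrMr// mul1r.
  exact: le_Re_cabs.
have [/andP[a0 api] ca] := acos_def x1; have sa := sin_acos x1.
have pi0 : 0 <= pi :> R := pi_ge0 R.
have sE : 1 - x ^+ 2 = (complex.Im z / cabs z) ^+ 2.
  rewrite /x !expr_div_n cabs_sqr; field.
  by rewrite -cabs_sqr expf_neq0.
move: sa; rewrite sE sqrtr_sqr normrM normfV (gtr0_norm r0) => sa.
have [im|im] := leP 0 (complex.Im z).
  exists (acos x); first by apply/andP; split; lra.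
  apply: complex_eq; rewrite /= ?ca ?sa ?ger0_norm// mulrC divfK//.
exists (- acos x); first by apply/andP; split; lra.
apply: complex_eq; rewrite /= ?cosN ?sinN ?ca ?sa.
  by rewrite mulrC divfK.
by rewrite ltr0_norm// mulrC !mulNr opprK divfK.
Qed.

Lemma continuous_complex (x y : R -> R) : continuous x -> continuous y ->
  continuous (fun t => (x t +i* y t)%C).
Proof.
move=> cx cy t P /nbhsC[e e0 h]; have e2 : 0 < e / 2 by rewrite divr_gt0.
move/cvgrPdist_lt : (cx t) => /(_ _ e2) hx; move/cvgrPdist_lt : (cy t) => /(_ _ e2) hy.
apply: filterS2 hx hy => u hx hy; apply: h; apply: le_lt_trans (cabs_le _) _ => /=.
by rewrite distrC [X in _ + X]distrC (splitr e) ltrD.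
Qed.

Lemma continuous_polar (x y : R -> R) : continuous x -> continuous y ->
  continuous (fun t => polar (x t) (y t)).
Proof.
move=> cx cy; apply: continuous_complex => t; apply: cvgM.
- exact: cx.
- by apply: (@continuous_comp _ _ _ y cos); [exact: cy|exact: continuous_cos].
- exact: cx.
- by apply: (@continuous_comp _ _ _ y sin); [exact: cy|exact: continuous_sin].
Qed.

Lemma continuous_polar1 : continuous (polar 1).
Proof.
apply: (@continuous_polar (fun=> 1) id); first exact: cst_continuous.
by move=> x; exact: cvg_id.
Qed.

Lemma continuous_lerp (a b : R) : continuous (fun t : R => (1 - t) * a + t * b).
Proof.
move=> t; apply: cvgD; apply: cvgM; [|exact: cvg_cst|exact: cvg_id|exact: cvg_cst].
exact: (cvgB (cvg_cst (1 : R)) cvg_id).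
Qed.

Lemma ccont_comp_path f gam t : ccont f (gam t) -> {for t, continuous gam} ->
  {for t, continuous (fun u => f (gam u))}.
Proof.
move=> fc gc P /nbhsC[e e0 h].
apply: (filterS (P := [set u | cabs (f (gam u) - f (gam t)) < e])) => [u /h//|].
exact: (gc _ (fc _ e0)).
Qed.

Lemma within_segment (T : topologicalType) (g : R -> T) (a b : R) :
  (forall t, a <= t <= b -> {for t, continuous g}) -> {within `[a, b], continuous g}.
Proof.
move=> h; apply: continuous_in_subspaceT => t /set_mem /=; rewrite in_itv /=.
exact: h.
Qed.

(** Along the path, being in the closure of [D] and being in its interior are
    the same, so the part of the path in [D] is relatively open and closed. *)
Lemma path_side (D : set C) gam :
  (forall t, 0 <= t <= 1 -> {for t, continuous gam}) ->
  (forall t, 0 <= t <= 1 -> ~ boundary D (gam t)) -> D (gam 0) -> D (gam 1).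
Proof.
move=> cg nb D0; have cA := connected_continuous_connected
  (@segment_connected R 0 1) (within_segment cg).
set A := gam @` `[0, 1] in cA.
have A0 : A (gam 0) by exists 0 => //=; rewrite in_itv /= lexx ler01.
have A1 : A (gam 1) by exists 1 => //=; rewrite in_itv /= lexx ler01.
have nbA z : A z -> closure D z -> interior D z.
  move=> [t tI <-] cD; apply: contrapT => nI.
  have t01 : 0 <= t <= 1 by move: tI; rewrite /= in_itv.
  by apply: (nb t t01).
suff : A `&` D = A by move=> E; move: A1; rewrite -E => -[].
apply: cA.
- by exists (gam 0).
- exists (interior D); first exact: open_interior.
  apply/seteqP; split=> z [Az Dz]; split=> //; last exact: interior_subset.
  by apply: nbA => //; exact: subset_closure.
- exists (closure D); first exact: closed_closure.
  apply/seteqP; split=> z [Az Dz]; split=> //; first exact: subset_closure.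
  by apply: interior_subset; exact: nbA.
Qed.

(** Interpolating modulus and argument gives a path in the annulus from [a] to
    [b], and [f] maps it off the boundary of [D]. *)
Lemma annulus_side N f D (lo hi : R) : 0 <= lo -> (forall w, N w -> ccont f w) ->
  (forall w, lo < cabs w < hi -> N w /\ ~ boundary D (f w)) ->
  forall a b, lo < cabs a < hi -> lo < cabs b < hi -> D (f a) -> D (f b).
Proof.
move=> lo0 fc hN a b ha hb.
have [/andP[a1 a2] /andP[b1 b2]] := (ha, hb).
have [ta _ aE] := polarE (le_lt_trans lo0 a1).
have [tb _ bE] := polarE (le_lt_trans lo0 b1).
pose rh t := (1 - t) * cabs a + t * cabs b.
pose th t := (1 - t) * ta + t * tb.
pose gam t := polar (rh t) (th t).
have g0 : gam 0 = a by rewrite /gam /rh /th subr0 !mul1r !mul0r !addr0.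
have g1 : gam 1 = b by rewrite /gam /rh /th subrr !mul1r !mul0r !add0r.
have cg : continuous gam by apply: continuous_polar; exact: continuous_lerp.
have gI t : 0 <= t <= 1 -> lo < cabs (gam t) < hi.
  move=> /andP[t0 t1]; rewrite /gam cabs_polar.
  have h1 : lo < rh t.
    rewrite /rh; have := ler_wpM2l t0 (ltW b1).
    have [->|tn] := eqVneq t 1; first by rewrite subrr; lra.
    have t1' : 0 < 1 - t by rewrite subr_gt0 lt_neqAle tn.
    have : (1 - t) * lo < (1 - t) * cabs a by rewrite ltr_pM2l.
    lra.
  have h2 : rh t < hi.
    rewrite /rh; have := ler_wpM2l t0 (ltW b2).
    have [->|tn] := eqVneq t 1; first by rewrite subrr; lra.
    have t1' : 0 < 1 - t by rewrite subr_gt0 lt_neqAle tn.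
    have : (1 - t) * cabs a < (1 - t) * hi by rewrite ltr_pM2l.
    lra.
  by rewrite ger0_norm ?h1 ?h2//; apply: le_trans lo0 (ltW h1).
move=> Da; rewrite -g1; apply: (@path_side D (fun t => f (gam t))).
- move=> t /gI/hN[Nt _]; apply: ccont_comp_path; [exact: fc|exact: cg].
- by move=> t /gI/hN[].
- by rewrite g0.
Qed.

(** Tube argument: the radius that works near each point of the circle can be
    taken uniform by compactness of the interval of arguments. *)
Lemma annulus_in N : open N -> (forall w, cabs w = 1 -> N w) ->
  exists s, [/\ 0 < s, s < 1 & forall w, `|cabs w - 1| < s -> N w].
Proof.
move=> oN circN.
have K := @segment_compact R (- pi) pi.
move/compact_near_coveringP : K => K.
have := K R (0 : R)^'+ (fun s theta => forall rho, `|rho - 1| < s -> N (polar rho theta)).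
case.
  move=> th _.
  have /circN Nth : cabs (polar 1 th) = 1 by rewrite cabs_polar normr1.
  have /nbhsC[d d0 hd] : nbhs (polar 1 th) N by exact: open_nbhs_nbhs.
  have d2 : 0 < d / 2 by rewrite divr_gt0.
  exists ([set x | cabs (polar 1 x - polar 1 th) < d / 2], [set s | s < d / 2]) => /=.
    split; last exact: nbhs_right_lt.
    by apply: (@continuous_polar1 th [set z | cabs (z - polar 1 th) < d / 2]);
      apply/nbhsC; exists (d / 2).
  move=> [x s] [hx hs] rho hr; apply: hd.
  have {}hx : cabs (polar 1 x - polar 1 th) < d / 2 := hx.
  have {}hs : s < d / 2 := hs.
  have {}hr : `|rho - 1| < s := hr.
  apply: le_lt_trans (cabs_tri (polar 1 x) _ _) _.
  have -> : polar rho x - polar 1 x = polar (rho - 1) x.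
    by apply: complex_eq => /=; ring.
  by rewrite cabs_polar; lra.
move=> s0 /= s00 h.
pose s := Num.min (s0 / 2) (1 / 2).
have s0p : 0 < s by rewrite lt_min !divr_gt0.
exists s; split=> //; first by rewrite gt_min; apply/orP; right; lra.
move=> w ws.
have s12 : s <= 1 / 2 by rewrite ge_min lexx orbT.
have w0 : 0 < cabs w by move: ws; rewrite ltr_norml => /andP[]; lra.
have [th tpi ->] := polarE w0.
apply: (h s) => //=.
rewrite sub0r normrN gtr0_norm//; apply: le_lt_trans (_ : s0 / 2 < s0).
  by rewrite ge_min lexx.
by rewrite ltr_pdivrMr// ltr_pMr// ltr1n.
Qed.

Lemma circle_curve_compact N f : (forall w, N w -> ccont f w) ->
  (forall w, cabs w = 1 -> N w) ->
  compact (c2r @` (f @` [set w | cabs w = 1])) /\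
  exists M, forall w, cabs w = 1 -> cabs (f w) <= M.
Proof.
move=> fc circN.
have c1 th : cabs (polar 1 th) = 1 by rewrite cabs_polar normr1.
have cf th : {for th, continuous (fun th => f (polar 1 th))}.
  by apply: ccont_comp_path; [apply: fc; exact: circN|exact: continuous_polar1].
have img (w : C) : cabs w = 1 -> exists2 th, th \in `[- pi, pi]%R & polar 1 th = w.
  move=> w1; have [|th tp wE] := @polarE w; first by rewrite w1.
  by exists th; rewrite ?in_itv// wE w1.
split.
  rewrite (_ : c2r @` _ = (fun th => c2r (f (polar 1 th))) @` `[- pi, pi]).
    apply: continuous_compact; last exact: segment_compact.
    apply: within_segment => th _; apply: continuous_comp; first exact: cf.
    exact: continuous_c2r.
  apply/seteqP; split=> [_ [_ [w /= w1 <-] <-]|_ [th _ <-]].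
    by have [th tp <-] := img w w1; exists th.
  by apply: imageP; apply: imageP; exact: c1.
have pp : - pi <= pi :> R by have := pi_ge0 R; lra.
have [|th _ hmax] := @EVT_max R (fun th => cabs (f (polar 1 th))) _ _ pp.
  apply: within_segment => t _; apply/cvgrPdist_lt => e e0.
  have := cf t [set z | cabs (z - f (polar 1 t)) < e]; case.
    by apply/nbhsC; exists e.
  move=> d /= d0 h; exists d => //= u /h /=; apply: le_lt_trans.
  by rewrite distrC cabs_dist.
exists (cabs (f (polar 1 th))) => w /img[th' tp' <-]; exact: hmax.
Qed.

(** The images of the inner and of the outer collar avoid the boundary, so
    each of them lies in [O] or is disjoint from it, and together with the
    curve they fill a neighbourhood of the curve. They are not both disjoint
    from [O], since the curve lies in the closure of [O]. If both were in [O],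
    the closure of [O] would be open, hence everything, and [O] would be the
    complement of a bounded curve. *)
Lemma side_exists O N f : open O -> open N -> (forall w, N w -> analytic_at f w) ->
  (forall x y, N x -> N y -> f x = f y -> x = y) ->
  (forall w, cabs w = 1 -> N w) ->
  (forall z, boundary O z <-> exists2 w, cabs w = 1 & f w = z) ->
  (forall M, exists2 z, M < cabs z & ~ O z) ->
  exists s sigma, [/\ 0 < s, sigma ^+ 2 = 1 & one_sided O f s sigma].
Proof.
move=> oO oN af inj circN bO out.
have [s [s0 s1 sN]] := annulus_in oN circN.
have fc w : N w -> ccont f w by move=> /af; exact: analytic_at_ccont.
have nbf w : `|cabs w - 1| < s -> cabs w != 1 -> ~ boundary O (f w).
  move=> ws w1 /bO[x x1 /inj E]; move: w1; rewrite -(E _ _) ?x1 ?eqxx//.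
  - exact: circN.
  - exact: sN.
have iO : interior O = O := (interior_id O).1 oO.
have nOb z : O z -> ~ boundary O z.
  by move=> Oz [_]; rewrite iO.
have inn a b : 1 - s < cabs a < 1 -> 1 - s < cabs b < 1 -> O (f a) -> O (f b).
  apply: (@annulus_side N f O (1 - s) 1) => //; first by rewrite subr_ge0 ltW.
  move=> w /andP[w1 w2]; have ws : `|cabs w - 1| < s by rewrite ltr_norml; apply/andP; split; lra.
  by split; [exact: sN|apply: nbf => //; rewrite lt_eqF].
have outt a b : 1 < cabs a < 1 + s -> 1 < cabs b < 1 + s -> O (f a) -> O (f b).
  apply: (@annulus_side N f O 1 (1 + s)) => //.
  move=> w /andP[w1 w2]; have ws : `|cabs w - 1| < s by rewrite ltr_norml; apply/andP; split; lra.
  by split; [exact: sN|apply: nbf => //; rewrite gt_eqF].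
pose ai : C := (1 - s / 2)%:C%C; pose ao : C := (1 + s / 2)%:C%C.
have aiE : cabs ai = 1 - s / 2 by rewrite cabs_real ger0_norm//; lra.
have aoE : cabs ao = 1 + s / 2 by rewrite cabs_real ger0_norm//; lra.
have ain : 1 - s < cabs ai < 1 by rewrite aiE; apply/andP; split; lra.
have aon : 1 < cabs ao < 1 + s by rewrite aoE; apply/andP; split; lra.
have circO w : cabs w = 1 -> ~ O (f w) by move=> w1 /nOb; apply; apply/bO; exists w.
have nbimg w : cabs w = 1 -> \forall z \near f w, exists2 x, `|cabs x - 1| < s & f x = z.
  move=> w1; have Nw := circN _ w1.
  have [r [_ _ _ [d d0 fd]]] := analytic_inj oN Nw (af _ Nw) inj.
  have nV : nbhs w [set x | `|cabs x - 1| < s].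
    apply/nbhsC; exists s => // x; apply: le_lt_trans.
    by rewrite -w1 cabs_dist.
  have [psi [_ _ H]] := local_inverse fd d0 nV.
  by apply: filterS H => z [h1 h2]; exists (psi z).
have c1 : cabs (1 : C) = 1 := cabs1 R.
have [Oi|nOi] := pselect (O (f ai)); have [Oo|nOo] := pselect (O (f ao)).
- exfalso.
  have [M hM] := (circle_curve_compact fc circN).2.
  have [z zM nOz] := out M.
  have ncz : ~ closure O z.
    move=> cz; have : boundary O z by split=> // /interior_subset.
    by move=> /bO[w w1 fw]; have := hM w w1; rewrite fw; lra.
  have bcl0 : boundary O `<=` closure O by move=> q hq; exact: hq.1.
  have bcl : boundary O `<=` interior (closure O).
    move=> _ /bO[w w1 <-]; rewrite /interior /=.
    apply: filterS (nbimg w w1) => _ [x xs <-].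
    have [x1|x1|x1] := ltgtP (cabs x) 1.
    + apply: subset_closure; apply: (inn ai) => //.
      by move: xs; rewrite ltr_norml => /andP[? ?]; apply/andP; split; lra.
    + apply: subset_closure; apply: (outt ao) => //.
      by move: xs; rewrite ltr_norml => /andP[? ?]; apply/andP; split; lra.
    + by apply: bcl0; apply/bO; exists x.
  have clop w : ~ boundary (closure O) w.
    move=> [cw nw]; apply: nw; move: cw; rewrite -(closure_id _).1; last exact: closed_closure.
    move=> cw; have [Ow|nOw] := pselect (O w).
      by apply: (interiorS (@subset_closure _ O)); rewrite iO.
    apply: bcl; split; [exact: cw|move=> hI; exact: nOw (interior_subset hI)].
  apply: ncz; pose g t := (((1 - t) * complex.Re (f ai) + t * complex.Re z) +i*
    ((1 - t) * complex.Im (f ai) + t * complex.Im z))%C.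
  have g1 : g 1 = z by apply: complex_eq => /=; ring.
  have g0 : g 0 = f ai by apply: complex_eq => /=; ring.
  rewrite -g1; apply: (@path_side (closure O) g).
  + move=> t _.
    exact: (continuous_complex (@continuous_lerp _ _) (@continuous_lerp _ _)).
  + by move=> t _; exact: clop.
  + by rewrite g0; exact: subset_closure.
- exists s, 1; split=> //; first by rewrite expr1n.
  move=> w; rewrite mul1r ltr_norml => /andP[w1 w2].
  have [x1|x1|x1] := ltgtP (cabs w) 1.
  + by split=> [_|_]; [lra|apply: (inn ai) => //; apply/andP; split; lra].
  + split=> [Ow|]; last by lra.
    by exfalso; apply: nOo; apply: (outt w) => //; apply/andP; split; lra.
  + by split=> [/(circO _ x1)//|]; lra.
- exists s, (-1); split=> //; first by rewrite sqrrN expr1n.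
  move=> w; rewrite mulN1r ltr_norml => /andP[w1 w2].
  have [x1|x1|x1] := ltgtP (cabs w) 1.
  + split=> [Ow|]; last by lra.
    by exfalso; apply: nOi; apply: (inn w) => //; apply/andP; split; lra.
  + by split=> [_|_]; [lra|apply: (outt ao) => //; apply/andP; split; lra].
  + by split=> [/(circO _ x1)//|]; lra.
- exfalso; have [cl _] : boundary O (f 1) by apply/bO; exists 1.
  have [z [Oz [x]]] := cl _ (nbimg 1 c1).
  rewrite ltr_norml => /andP[xs1 xs2] fx; move: Oz; rewrite -fx => Ox.
  have [x1|x1|x1] := ltgtP (cabs x) 1.
  + by apply: nOi; apply: (inn x) => //; apply/andP; split; lra.
  + by apply: nOo; apply: (outt x) => //; apply/andP; split; lra.
  + exact: circO x1 Ox.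
Qed.

End CurveSides.

(** * A large circle does not contract in the complement of a point *)

Section WindingParity.
Variable R : realType.
Local Notation C := R[i].
Implicit Types (z w q : C) (e s t rho theta : R) (O : set C).

Lemma cabs_lt1_Re z : cabs (z - 1) < 1 -> 0 < complex.Re z.
Proof.
move=> h; have := le_lt_trans (le_Re_cabs (z - 1)) h.
by rewrite ReB /= ltr_norml => /andP[]; lra.
Qed.

Lemma Re_inv_gt0 z : 0 < complex.Re z -> 0 < complex.Re z^-1.
Proof.
case: z => a b /= a0; rewrite divr_gt0// ltr_pwDl ?exprn_gt0 ?sqr_ge0//.
Qed.

(** [z + cabs z] has half the argument of [z]; no continuous choice of a
    square root is involved. *)
Lemma half_angle z : 0 < complex.Re z -> 0 < (z + (cabs z)%:C%C) ^+ 2 / z.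
Proof.
move=> z0; have zn : z != 0 by apply: contraTneq z0 => ->; rewrite ltxx.
have E : (z + (cabs z)%:C%C) ^+ 2 = z * (2 * (complex.Re z + cabs z))%:C%C.
  have := cabs_sqr z; set c := cabs z; case: (z) => a b /= hc.
  by apply: complex_eq; rewrite expr2 ?ReM ?ImM /=; nra.
rewrite E mulrC mulrA mulVf// mul1r ltcR mulr_gt0//.
by rewrite ltr_pwDl// cabs_ge0.
Qed.

(** [r] is a continuous closed square root of the loop [h] up to positive
    factors; one exists exactly when [h] winds an even number of times around
    0. Allowing positive factors dispenses with normalizations. *)
Definition pos_sqrt (h r : R -> C) := [/\ forall t, 0 <= t <= 1 -> ccont r t,
  r 0 = r 1 & forall t, 0 <= t <= 1 -> 0 < r t ^+ 2 / h t].

(** When the ratio [v] of the two loops stays in the right half-plane, [v +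
    cabs v] is a square root of it up to positive factors. *)
Lemma pos_sqrt_transfer (h1 h2 r : R -> C) :
  (forall t, 0 <= t <= 1 -> [/\ ccont h1 t, ccont h2 t, h1 t != 0, h2 t != 0 &
     0 < complex.Re (h2 t / h1 t)]) ->
  h1 0 = h1 1 -> h2 0 = h2 1 -> pos_sqrt h1 r -> exists r', pos_sqrt h2 r'.
Proof.
move=> hh h101 h201 [rc r01 rp]; pose v t := h2 t / h1 t.
exists (fun t => r t * (v t + (cabs (v t))%:C%C)); split.
- move=> t t01; have [c1 c2 n1 n2 _] := hh t t01.
  have vc : ccont v t by apply: ccontM => //; exact: ccontV.
  by apply: ccontM; [exact: rc|apply: ccontD => //; exact: ccont_cabs].
- by rewrite /v r01 h101 h201.
- move=> t t01; have [c1 c2 n1 n2 vp] := hh t t01.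
  have -> : (r t * (v t + (cabs (v t))%:C%C)) ^+ 2 / h2 t =
      (r t ^+ 2 / h1 t) * ((v t + (cabs (v t))%:C%C) ^+ 2 / v t).
    by rewrite /v; field; rewrite n1 n2.
  by rewrite mulr_gt0 ?rp ?half_angle.
Qed.

Lemma segment_tube (h : R * R -> C) s : (forall p, ccont h p) ->
  (forall p, h p != 0) ->
  \forall s' \near s, forall t, 0 <= t <= 1 ->
    cabs (h (t, s') - h (t, s)) < cabs (h (t, s)).
Proof.
move=> hc h0; have K := @segment_compact R 0 1.
move/compact_near_coveringP : K => K.
have := K R (nbhs s) (fun s' t => cabs (h (t, s') - h (t, s)) < cabs (h (t, s))).
case.
  move=> t _; set m := cabs (h (t, s)).
  have m0 : 0 < m / 3 by rewrite divr_gt0// cabs_gt0.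
  have [[A B] /= [nA nB] AB] := hc (t, s) _ m0.
  exists (A, B) => //= -[t' s'] /= [At' Bs'].
  have h1 := AB (t', s') (conj At' Bs').
  have h2 := AB (t', s) (conj At' (nbhs_singleton nB)).
  move: h1 h2 => /= h1 h2.
  have := cabs_tri (h (t, s)) (h (t', s')) (h (t', s)).
  have := cabsBD (h (t, s)) (h (t', s)).
  rewrite (cabsB (h (t, s)) (h (t', s))) -/m; lra.
move=> d /= d0 H; exists d => //= s' /H hs' t t01; exact: hs'.
Qed.

(** Dividing by the half-turn [polar 1 (pi * t)], whose square is the circle
    up to the radius, would leave a function with nonzero real part whose
    values at 0 and 1 are opposite. *)
Lemma circle_no_pos_sqrt rho r : 0 < rho ->
  ~ pos_sqrt (fun t => polar rho (pi * t + pi * t)) r.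
Proof.
move=> rho0 [rc r01 rp].
pose v t : C := polar 1 (pi * t).
have vc t : ccont v t.
  have : continuous v.
    apply: (@continuous_polar _ (fun=> 1) (fun t => pi * t)); first exact: cst_continuous.
    exact: mulrl_continuous.
  move=> cv e e0; apply: (cv t [set z | cabs (z - v t) < e]); apply/nbhsC; by exists e.
have v2 t : polar rho (pi * t + pi * t) = rho%:C%C * v t ^+ 2.
  by apply: complex_eq; rewrite expr2 ?ReM ?ImM /= ?cosD ?sinD; ring.
have v1 t : v t != 0 by rewrite -cabs_gt0 cabs_polar normr1.
have rhoc : rho%:C%C != 0 :> C by rewrite -cabs_gt0 cabs_real gtr0_norm.
have rr t : 0 <= t <= 1 -> complex.Re (r t / v t) != 0.
  move=> /rp; rewrite v2; set y := r t / v t => h.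
  have : 0 < y ^+ 2.
    have -> : y ^+ 2 = (r t ^+ 2 / (rho%:C%C * v t ^+ 2)) * rho%:C%C.
      by rewrite /y; field; rewrite ?v1 ?rhoc.
    by rewrite mulr_gt0// ltcR.
  rewrite ltcE expr2 ReM ImM /= => /andP[/eqP E1 E2]; apply/eqP => y0.
  by move: E2; rewrite y0; have := sqr_ge0 (complex.Im y); rewrite expr2; lra.
pose x t := complex.Re (r t / v t).
have x01 : x 1 = - x 0.
  rewrite /x -r01 /v mulr1 mulr0 /polar cospi sinpi cos0 sin0 !mul1r.
  have -> : (-1 +i* 0)%C = -1 :> C by apply: complex_eq => /=; rewrite ?oppr0.
  have -> : (1 +i* 0)%C = 1 :> C by [].
  by rewrite invrN invr1 mulrN1 mulr1 ReN.
have xc : {within `[0, 1], continuous x}.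
  apply: within_segment => t t01; apply/cvgrPdist_lt => e e0.
  have := ccontM (rc t t01) (ccontV (vc t) (v1 t)) e0.
  apply: filterS => u; apply: le_lt_trans; rewrite /x -ReB cabsB; exact: le_Re_cabs.
have [|t] := IVT (v := 0) (ler01 : (0 : R) <= 1) xc.
  rewrite x01 ge_min le_max oppr_le0 oppr_ge0.
  by have [h|h] := leP 0 (x 0); rewrite ?(ltW h) ?orbT.
by rewrite in_itv /= => /rr/eqP h /h.
Qed.

(** Nearby slices of a homotopy have a ratio in the right half-plane, so the
    parameters [s] whose slice has such a square root form an open and closed
    set. *)
Lemma null_homotopy_pos_sqrt (h : R * R -> C) : (forall p, ccont h p) ->
  (forall p, h p != 0) -> (forall s, h (0, s) = h (1, s)) ->
  (exists r, pos_sqrt (fun t => h (t, 1)) r) ->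
  exists r, pos_sqrt (fun t => h (t, 0)) r.
Proof.
move=> hc h0 h01 h1.
pose A s := exists r, pos_sqrt (fun t => h (t, s)) r.
have slice s t : ccont (fun t => h (t, s)) t.
  move=> e e0; have [[X Y] /= [nX nY] XY] := hc (t, s) e e0.
  by apply: filterS nX => u Xu; apply: (XY (u, s)); split=> //; exact: nbhs_singleton nY.
have loc s : \forall s' \near s, (A s <-> A s').
  apply: filterS (segment_tube s hc h0) => s' H.
  have P t : 0 <= t <= 1 -> 0 < complex.Re (h (t, s') / h (t, s)).
    move=> /H h2; apply: cabs_lt1_Re.
    have -> : h (t, s') / h (t, s) - 1 = (h (t, s') - h (t, s)) / h (t, s).
      by field.
    by rewrite cabsM cabsV ltr_pdivrMr ?mul1r// cabs_gt0.
  split=> -[r hr]; apply: pos_sqrt_transfer hr => // t t01; split=> //; first exact: P.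
  have -> : h (t, s) / h (t, s') = (h (t, s') / h (t, s))^-1 by rewrite invf_div.
  exact/Re_inv_gt0/P.
have oA : open A.
  by rewrite openE => s As; apply: filterS (loc s) => s' [+ _]; exact.
have oAC : open (~` A).
  by rewrite openE => s As; apply: filterS (loc s) => s' [_ h2] /h2.
pose I : set R := [set` `[(0 : R), 1]%R].
suff E : I `&` A = I.
  have : I 0 by rewrite /I /= in_itv /= lexx ler01.
  by rewrite -E => -[].
apply: (@segment_connected R 0 1).
- by exists 1; split=> //; rewrite /I /= in_itv /= lexx ler01.
- by exists A.
- by exists A => //; rewrite -[A]setCK; exact: open_closedC.
Qed.

(** Composition with this retraction extends a homotopy from the unit square
    to the whole plane, where continuity is no longer relative to a subset. *)
Definition clamp (t : R) := Num.min 1 (Num.max 0 t).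

Lemma clamp_itv t : 0 <= clamp t <= 1.
Proof. by rewrite /clamp ge_min lexx le_min ler01 le_max lexx. Qed.

Lemma clamp_id t : 0 <= t <= 1 -> clamp t = t.
Proof. by move=> /andP[t0 t1]; rewrite /clamp max_r// min_r. Qed.

Lemma clamp_continuous : continuous clamp.
Proof.
move=> t; apply: (@continuous_min R R (fun=> 1) (fun t => Num.max 0 t)).
  exact: cst_continuous.
apply: (@continuous_max R R (fun=> 0) id); first exact: cst_continuous.
exact: cvg_id.
Qed.

(** A large circle around [q] lies in [O] and would contract in the complement
    of [q], although it winds once around [q]. *)
Lemma loops_not_contract O q M : (forall z, M < cabs z -> O z) -> ~ O q ->
  ~ loops_contract R O.
Proof.
move=> OM nOq lc; pose rho := `|M| + cabs q + 1.
have q0 := cabs_ge0 q; have M0 := normr_ge0 M; have MM := ler_norm M.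
have rho0 : 0 < rho by rewrite /rho; lra.
pose g t := q + polar rho (pi * t + pi * t).
have cpol : continuous (fun t => polar rho (pi * t + pi * t)).
  apply: (@continuous_polar _ (fun=> rho) (fun t => pi * t + pi * t)).
    exact: cst_continuous.
  by move=> t; apply: cvgD; exact: mulrl_continuous.
have gc : continuous g.
  move=> t P /nbhsC[e e0 H].
  have := cpol t [set z | cabs (z - polar rho (pi * t + pi * t)) < e]; case.
    by apply/nbhsC; exists e.
  move=> d /= d0 hd; exists d => //= u /hd /= hu; apply: H.
  by rewrite /g opprD addrACA subrr add0r.
have g01 : g 0 = g 1.
  have c2 : cos (pi + pi) = 1 :> R by rewrite cosD cospi sinpi; ring.
  have s2 : sin (pi + pi) = 0 :> R by rewrite sinD cospi sinpi; ring.
  by rewrite /g /polar !mulr1 !mulr0 addr0 c2 s2 cos0 sin0.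
have gO : g @` `[0, 1] `<=` O.
  move=> _ [t _ <-]; apply: OM; rewrite /g.
  have := cabsBD (polar rho (pi * t + pi * t)) (- q).
  rewrite opprK (addrC _ q) cabsN cabs_polar gtr0_norm// /rho; lra.
have [H [Hc HO H0 H1]] := lc g (within_segment (fun t _ => gc t)) gO g01.
pose h (p : R * R) := H (clamp p.1, clamp p.2) - q.
have cl0 : clamp 0 = 0 by rewrite clamp_id ?lexx ?ler01.
have cl1 : clamp 1 = 1 by rewrite clamp_id ?lexx ?ler01.
have cl2 p : (`[0, 1] `*` `[0, 1] : set (R * R)) (clamp p.1, clamp p.2).
  by split; rewrite /= in_itv /= clamp_itv.
have hc p : ccont h p.
  have := (subspace_continuousP _ _).1 Hc _ (cl2 p).
  move=> HH e e0; have := HH [set z | cabs (z - H (clamp p.1, clamp p.2)) < e]; case.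
    by apply/nbhsC; exists e.
  move=> [X Y] /= [nX nY] XY.
  have nX' := clamp_continuous nX; have nY' := clamp_continuous nY.
  exists (clamp @^-1` X, clamp @^-1` Y) => //= -[a b] /= [Xa Yb].
  have := XY (clamp a, clamp b) (conj Xa Yb) (cl2 (a, b)).
  by rewrite /h opprB addrA subrK.
have h0 p : h p != 0.
  rewrite subr_eq0; apply/eqP => E; apply: nOq; rewrite -E; apply: HO.
  exact: imageP (cl2 p).
have h01 s : h (0, s) = h (1, s).
  by rewrite /h /= cl0 cl1 (H1 _ (clamp_itv s)).1 (H1 _ (clamp_itv s)).2.
have [|r hr] := null_homotopy_pos_sqrt hc h0 h01.
  exists (fun=> 1); split=> // [t _|t t01].
    by move=> e e0; apply: filterE => u; rewrite subrr cabs0.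
  rewrite /h /= (clamp_id t01) cl1 (H0 _ t01).2.
  rewrite /g addrAC subrr add0r mulr0 addr0 /polar cos0 sin0 mulr1 mulr0.
  by rewrite expr1n mul1r invr_gt0 ltcR.
apply: (@circle_no_pos_sqrt rho r rho0).
case: hr => [r1 r2 r3]; split=> // t t01; move: (r3 t t01).
rewrite /h /= (clamp_id t01) cl0 (H0 _ t01).1.
by rewrite /g addrAC subrr add0r.
Qed.

End WindingParity.

(** * The unit disk and analytic simply connected domains *)

Section MainTheorem.
Variable R : realType.
Local Notation C := R[i].
Local Notation c2r := (@R2_of_complex R).
Implicit Types (z w : C) (O N : set C) (f : C -> C).

Lemma unit_circleE : @unit_circle R = [set w | cabs w = 1].
Proof.
apply/seteqP; split=> w; rewrite /unit_circle /mkset normE.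
  exact: complexI.
by move=> ->.
Qed.

Lemma unit_diskE : @unit_disk R = [set w | cabs w < 1].
Proof. by apply/seteqP; split=> w; rewrite /unit_disk /mkset -cabs_lt_norm. Qed.

(** The last condition excludes a set lying on both sides of the curve, such
    as the complement of the curve. *)
Lemma SULD_of_curve O N f : open O -> connected O -> open N ->
  @unit_circle R `<=` N -> (forall w, N w -> analytic_at f w) -> set_inj N f ->
  boundary O = f @` @unit_circle R -> (forall M : R, exists2 z, M < cabs z & ~ O z) ->
  SULD (c2r @` O).
Proof.
move=> oO cO oN cN af injN bO out; rewrite unit_circleE in cN bO.
have inj x y : N x -> N y -> f x = f y -> x = y.
  by move=> Nx Ny; apply: injN; exact/mem_set.
have circN w : cabs w = 1 -> N w by exact: cN.
have bO' z : boundary O z <-> exists2 w, cabs w = 1 & f w = z by rewrite bO.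
have [s [sigma [s0 s1 side]]] := side_exists oO oN af inj circN bO' out.
have fc w : N w -> ccont f w by move=> /af; exact: analytic_at_ccont.
apply: SULD_of_charts => //.
- exists (f 1); apply/bO'; exists 1 => //; exact: cabs1.
- by rewrite bO; exact: (circle_curve_compact fc circN).1.
- by move=> p /bO'[w w1 <-]; exact: (chart_of_side oN af inj circN bO' s0 s1 side w1).
Qed.

Lemma analytic_at_id w : analytic_at (@id C) w.
Proof.
pose a k : C := if k is k'.+1 then (k' == 0%N)%:R else w.
exists a, 1; split=> // z _; apply/ctendsP; apply: ctends_unshift; apply: ctends_unshift.
rewrite (_ : (fun _ => _) = fun=> z); first exact: ctends_cst.
apply/funext => n; rewrite /series /= big_nat_recl// big_nat_recl//= big1 => [|k _].
  by rewrite expr0 expr1 mulr1 mul1r addr0 addrC subrK.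
by rewrite mul0r.
Qed.

Lemma connected_unit_disk : connected (@unit_disk R).
Proof.
pose seg z := (fun t : R => (t * complex.Re z +i* (t * complex.Im z))%C) @` `[0, 1].
have segE t z : (t * complex.Re z +i* (t * complex.Im z))%C = t%:C%C * z.
  by apply: complex_eq; rewrite ?ReM ?ImM /=; ring.
have -> : @unit_disk R = \bigcup_(z in @unit_disk R) seg z.
  rewrite unit_diskE; apply/seteqP; split=> [z zd|_ [z zd [t tI <-]]].
    exists z => //; exists 1; first by rewrite /= in_itv /= lexx ler01.
    by rewrite segE mul1r.
  have /andP[t0 t1] : 0 <= t <= 1 by move: tI; rewrite /= in_itv.
  rewrite /mkset segE cabsM cabs_real ger0_norm//; apply: le_lt_trans zd.
  by rewrite ler_piMl// cabs_ge0.
apply: bigcup_connected => [|z _].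
  exists 0 => z _; exists 0; first by rewrite /= in_itv /= lexx ler01.
  by rewrite segE mul0r.
apply: connected_continuous_connected; first exact: segment_connected.
apply: within_segment => t _; move: t; apply: continuous_complex => t;
  exact: mulrr_continuous.
Qed.

Lemma boundary_unit_disk : boundary (@unit_disk R) = @unit_circle R.
Proof.
rewrite unit_diskE unit_circleE.
have oD : open [set w : C | cabs w < 1] by exact: open_cball0.
apply/seteqP; split=> [z [cz]|z /= z1].
  rewrite (interior_id _).1// => /negP; rewrite -leNgt => z1.
  apply/eqP; rewrite eq_le z1 andbT; apply/ler_addgt0Pr => e e0.
  have [|w [w1 /= wz]] := cz [set w | cabs (w - z) < e].
    by apply/nbhsC; exists e.
  have := cabsBD z w; rewrite cabsB; have : cabs w < 1 by []. 
  lra.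
split; last by move=> /interior_subset /=; rewrite z1 ltxx.
move=> P /nbhsC[e e0 h]; pose t := Num.min (e / 2) (1 / 2).
have t0 : 0 < t by rewrite lt_min !divr_gt0.
have t1 : t <= 1 / 2 by rewrite ge_min lexx orbT.
have te : t <= e / 2 by rewrite ge_min lexx.
exists ((1 - t)%:C%C * z); split.
  by rewrite /= cabsM cabs_real z1 mulr1 ger0_norm; lra.
apply: h; have -> : (1 - t)%:C%C * z - z = (- t)%:C%C * z.
  by rewrite rmorphB rmorphN rmorph1; ring.
by rewrite cabsM cabs_real z1 mulr1 normrN gtr0_norm//; lra.
Qed.

Lemma SULD_unit_disk : SULD (c2r @` @unit_disk R).
Proof.
apply: (@SULD_of_curve _ setT id).
- by rewrite unit_diskE; exact: open_cball0.
- exact: connected_unit_disk.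
- exact: openT.
- by [].
- by move=> w _; exact: analytic_at_id.
- by move=> x y _ _.
- by rewrite image_id boundary_unit_disk.
- move=> M; exists (`|M| + 1)%:C%C; rewrite ?unit_diskE /mkset cabs_real ger0_norm ?addr_ge0//.
    by have := ler_norm M; lra.
  by move=> h; have := normr_ge0 M; lra.
Qed.

Lemma SULD_analytic_domain O : analytic_simply_connected_domain O -> SULD (c2r @` O).
Proof.
move=> [oO cO [_ lc] _ [N [f [oN cN af inj bO]]]].
apply: (SULD_of_curve oO cO oN cN af inj bO) => M.
apply: contrapT => nex; apply: (@loops_not_contract R O (f 1) M _ _ lc).
  by move=> z Mz; apply: contrapT => nOz; apply: nex; exists z.
have [_] : boundary O (f 1).
  by rewrite bO; apply: imageP; rewrite unit_circleE /mkset cabs1.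
by rewrite (interior_id O).1.
Qed.

End MainTheorem.

Theorem proposition2p10 (R : realType) :
  SULD (@R2_of_complex R @` @unit_disk R) /\
  forall Omega : set R[i], analytic_simply_connected_domain Omega ->
    SULD (@R2_of_complex R @` Omega).
Proof. by split=> [|Omega]; [exact: SULD_unit_disk|exact: SULD_analytic_domain]. Qed.
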